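(* Let $n\ge 2$ and let $K$ be the $(n-2)$-skeleton (codimension 2 skeleton) of the $n$-simplex. The space $C(K)$ of unlabeled codimension 2 skeleta of the $n$-simplex linearly embedded in $\mathbb R^n$ deformation retracts to the pyramidal space $P(K)$.
   Context: A linear embedding of $K$ in $\mathbb R^n$ is an injective map $K\to\mathbb R^n$ that is affine on each simplex; it is determined by the images of the $n+1$ vertices, so the space $E(K)$ of linear embeddings is a subspace of $(\mathbb R^n)^{n+1}$. $C(K)=E(K)/S_{n+1}$ is the quotient by relabeling of vertices. The pyramidal space $P(K)\subset C(K)$ consists of the configurations such that: $n$ of the $n+1$ vertices are the vertices of a regular $(n-1)$-simplex $F$ with unit edge length; the remaining vertex (the apex) lies on the line perpendicular to $F$ through the barycenter of $F$; the height of the apex (its distance from the barycenter of $F$) is between $0$ and the height of a regular $n$-simplex with unit edges, both values included; and the barycenter of the configuration is at the origin. *)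

(* Defs.v *)
From HB Require Import structures.
From mathcomp Require Import all_boot all_order all_algebra all_fingroup.
From mathcomp Require Import all_classical all_reals all_analysis.
From mathcomp Require Import ring lra.

Set Implicit Arguments.
Unset Strict Implicit.
Unset Printing Implicit Defensive.

Import Order.TTheory GRing.Theory Num.Theory.
Import numFieldNormedType.Exports.

Local Open Scope classical_set_scope.
Local Open Scope ring_scope.
Local Open Scope quotient_scope.

(* The library norm on 'rV[R]_n is the sup norm, which induces the usual
   topology but not the Euclidean distance. *)
Definition dotp (R : realType) (n : nat) (u v : 'rV[R]_n) : R :=
  \sum_(k < n) u 0 k * v 0 k.

Definition edist (R : realType) (n : nat) (u v : 'rV[R]_n) : R :=
  Num.sqrt (dotp (u - v) (u - v)).

(* A simplicial complex on the vertices 'I_N is given by its set of nonempty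
   faces; a face of dimension k has k + 1 vertices. *)
Definition skeleton (N k : nat) : {set {set 'I_N}} :=
  [set s : {set 'I_N} | (s != finset.set0) && (#|s| <= k.+1)%N].

(* The closed simplex spanned by the face s, in barycentric coordinates: the
   i-th vertex is delta_mx 0 i. *)
Definition simplex (R : realType) (N : nat) (s : {set 'I_N}) : set 'rV[R]_N :=
  [set t : 'rV[R]_N | [/\ forall i, 0 <= t 0 i,
                          \sum_(i < N) t 0 i = 1
                        & forall i, i \notin s -> t 0 i = 0]].

Definition realization (R : realType) (N : nat) (K : {set {set 'I_N}}) :
    set 'rV[R]_N :=
  [set t : 'rV[R]_N | exists2 s, s \in K & simplex s t].

Definition affine_on (R : realType) (N n : nat) (A : set 'rV[R]_N)
    (f : 'rV[R]_N -> 'rV[R]_n) : Prop :=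
  forall (p q : 'rV[R]_N) (l : R), A p -> A q -> 0 <= l <= 1 ->
    f (l *: p + (1 - l) *: q) = l *: f p + (1 - l) *: f q.

Definition linear_embedding (R : realType) (N n : nat) (K : {set {set 'I_N}})
    (f : 'rV[R]_N -> 'rV[R]_n) : Prop :=
  {in realization K &, injective f} /\
  forall s, s \in K -> affine_on (simplex s) f.

(* A point of (R^n)^N is an N x n matrix whose i-th row is the i-th point; a
   linear embedding is identified with the images of the N vertices. *)
Definition embeddings (R : realType) (n N : nat) (K : {set {set 'I_N}}) :
    set 'M[R]_(N, n) :=
  [set x : 'M[R]_(N, n) | exists2 f : 'rV[R]_N -> 'rV[R]_n,
     linear_embedding K f & forall i, row i x = f (delta_mx 0 i)].

(* E(K), with the topology induced by that of the space of matrices. *)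
Definition embedding_space (R : realType) (n N : nat) (K : {set {set 'I_N}}) :
  topologicalType := set_type (@embeddings R n N K).

Definition relabel (R : realType) (n N : nat) (K : {set {set 'I_N}})
    (x y : embedding_space R n K) : bool :=
  [exists s : 'S_N, set_val y == row_perm s (set_val x)].

Lemma relabel_equiv (R : realType) (n N : nat) (K : {set {set 'I_N}}) :
  equiv_class_of (@relabel R n N K).
Proof.
split=> [x|x y|y x z].
- by apply/existsP; exists 1%g; rewrite row_perm1.
- have sym a b : @relabel R n N K a b -> relabel b a.
    move=> /existsP[s /eqP e]; apply/existsP; exists s^-1%g.
    by rewrite e -row_permM mulVg row_perm1.
  by apply/idP/idP; exact: sym.
- move=> /existsP[s /eqP xy] /existsP[t /eqP yz].
  by apply/existsP; exists (t * s)%g; rewrite yz xy -row_permM.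
Qed.

Canonical relabel_equiv_rel (R : realType) (n N : nat)
    (K : {set {set 'I_N}}) :=
  EquivRelPack (@relabel_equiv R n N K).

(* C(K), with the quotient topology. *)
Definition config_space (R : realType) (n N : nat) (K : {set {set 'I_N}}) :
    topologicalType :=
  quotient_topology {eq_quot @relabel_equiv_rel R n N K}.

Definition config_class (R : realType) (n N : nat) (K : {set {set 'I_N}})
    (x : embedding_space R n K) : config_space R n K :=
  \pi_(quotient_topology {eq_quot @relabel_equiv_rel R n N K}) x.

Definition barycenter (R : realType) (n N : nat) (A : {set 'I_N})
    (x : 'M[R]_(N, n)) : 'rV[R]_n :=
  #|A|%:R^-1 *: \sum_(i in A) row i x.

(* Distance from the vertex a to the barycenter of the opposite face. *)
Definition height (R : realType) (n N : nat) (a : 'I_N) (x : 'M[R]_(N, n)) : R :=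
  edist (row a x) (barycenter [set~ a]%SET x).

Definition regular_height (R : realType) (n : nat) : R :=
  Num.sqrt (n.+1%:R / (2 * n%:R)).

Lemma dotpE (R : realType) (n : nat) (u v : 'rV[R]_n) :
  dotp u v = (u *m v^T) 0 0.
Proof. by rewrite mxE; apply: eq_bigr => k _; rewrite mxE. Qed.

Lemma height_regular (R : realType) (n : nat) (a : 'I_n.+1)
    (x : 'M[R]_(n.+1, n)) :
  (0 < n)%N ->
  (forall i j, i != j -> edist (row i x) (row j x) = 1) ->
  height a x = regular_height R n.
Proof.
move=> n0 unit_edge; rewrite /height /regular_height /edist; congr Num.sqrt.
pose w i := row a x - row i x.
have dot1 i j : i != j -> dotp (row i x - row j x) (row i x - row j x) = 1.
  move=> /unit_edge /(congr1 (fun r => r ^+ 2)); rewrite expr1n sqr_sqrtr //.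
  by apply: sumr_ge0 => k _; rewrite -expr2 sqr_ge0.
have dotw i j : i != a -> j != a -> dotp (w i) (w j) = (1 + (i == j)%:R) / 2.
  move=> ia ja.
  have wi : dotp (w i) (w i) = 1 by apply: dot1; rewrite eq_sym.
  have wj : dotp (w j) (w j) = 1 by apply: dot1; rewrite eq_sym.
  have [-> | ij] := eqVneq i j; first by rewrite wj /=; lra.
  have e : dotp (w i) (w i) + dotp (w j) (w j) - 2 * dotp (w i) (w j) = 1.
    rewrite -[RHS](dot1 _ _ ij) /dotp mulr_sumr -big_split -sumrB /=.
    by apply: eq_bigr => k _; rewrite !mxE; ring.
  by move: e; rewrite wi wj addr0 => e; lra.
have nF : #|[set~ a]%SET| = n by rewrite cardsC1 card_ord.
have n0R : n%:R != 0 :> R by rewrite pnatr_eq0 -lt0n.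
have sumF (V : lmodType R) (v : V) : \sum_(i in [set~ a]%SET) v = n%:R *: v.
  by rewrite sumr_const nF scaler_nat.
have -> : row a x - barycenter [set~ a]%SET x =
    n%:R^-1 *: \sum_(i in [set~ a]%SET) w i.
  by rewrite sumrB sumF scalerBr scalerA mulVf // scale1r /barycenter nF.
have dotpZ c u v : dotp (c *: u) (c *: v) = c ^+ 2 * dotp u v :> R.
  by rewrite /dotp mulr_sumr; apply: eq_bigr => k _; rewrite !mxE; ring.
have dot_sum : dotp (\sum_(i in [set~ a]%SET) w i) (\sum_(i in [set~ a]%SET) w i)
    = \sum_(i in [set~ a]%SET) \sum_(j in [set~ a]%SET) dotp (w i) (w j).
  rewrite dotpE mulmx_suml summxE; apply: eq_bigr => i _.
  rewrite (raddf_sum trmx) mulmx_sumr summxE.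
  by apply: eq_bigr => j _; rewrite dotpE.
have dot_row i : i \in [set~ a]%SET ->
    \sum_(j in [set~ a]%SET) dotp (w i) (w j) = (n%:R + 1) / 2.
  move=> iF; have ia : i != a by rewrite !inE in iF.
  have dotwi j : j \in [set~ a]%SET ->
      dotp (w i) (w j) = (1 + (i == j)%:R) / 2.
    by rewrite !inE => ja; exact: dotw.
  rewrite (eq_bigr _ dotwi).
  rewrite -mulr_suml big_split /= sumr_const nF (bigD1 i) //= eqxx.
  rewrite big1 ?addr0 // => j /andP[_ ji].
  by rewrite eq_sym (negbTE ji).
rewrite dotpZ dot_sum (eq_bigr _ dot_row) sumr_const nF -mulr_natr -natr1.
by field.
Qed.

(* Every row except the a-th one is a vertex of the base F; the a-th one is the
   apex. *)
Definition pyramid (R : realType) (n : nat) (a : 'I_n.+1)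
    (x : 'M[R]_(n.+1, n)) : Prop :=
  [/\ forall i j, i != a -> j != a -> i != j -> edist (row i x) (row j x) = 1,
      forall i j, i != a -> j != a ->
        dotp (row a x - barycenter [set~ a]%SET x) (row i x - row j x) = 0,
      0 <= height a x <= regular_height R n
    & barycenter [set: 'I_n.+1]%SET x = 0].

Definition pyramidal_space (R : realType) (n : nat)
    (K : {set {set 'I_n.+1}}) : set (config_space R n K) :=
  [set c | exists (x : embedding_space R n K) (a : 'I_n.+1),
     c = config_class x /\ pyramid a (set_val x)].

Definition deformation_retracts_to (R : realType) (X : topologicalType)
    (A : set X) : Prop :=
  exists H : R -> X -> X,
    [/\ {within `[0%R, 1%R]%classic `*` [set: X],
           continuous (fun p : R * X => H p.1 p.2)},
        forall c, H 0 c = c,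
        forall c, A (H 1 c)
      & forall (t : R) c, 0 <= t <= 1 -> A c -> H t c = c].

(* Main.v *)
From mathcomp Require Import all_boot all_order all_algebra all_fingroup.
From mathcomp Require Import all_classical all_reals all_analysis.
From mathcomp Require Import ring lra zify.
Require Import Defs.

(** A configuration is a matrix [x] whose n+1 rows are points of R^n.  Its
    codimension 2 skeleton is embedded exactly when every nonzero affine
    dependency between the rows has one entry of one sign and all the others
    strictly of the opposite sign ([embeddings_admissible]).  So either the
    vertices are affinely independent, or one of them, the apex, lies in the
    relative interior of the simplex spanned by the others.

    Centred pyramids are recognized on their Gram matrix.  Let [compress a k]
    be the symmetric matrix that annihilates the constant vectors, multiplies
    the direction of the centred basis vector of the vertex [a] by [k], and
    is the identity on the orthogonal of both.  Then [x] is a pyramid with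
    apex [a] and height [k] times the regular height exactly when
    [x *m x^T = 2^-1 *: compress a (k ^+ 2)] ([pyramid_of_gram],
    [gram_of_pyramid]).

    Every admissible [x] determines such a matrix [D], its [flattener].  By
    the relation of Minkowski the facet normals weighted by the areas sum to
    zero, so the area of the facet opposite to [a] is at most the sum of the
    other areas, with equality when [x] is degenerate with apex [a].
    [height_ratio x a] is a function of these areas which is continuous on
    admissible configurations, vanishes when [x] is degenerate with apex [a],
    equals 1 unless the facet opposite to [a] is strictly larger than all the
    others (so that it differs from 1 for at most one [a]), and is the
    correct ratio on pyramids.

    The pyramid attached to [x] is [model x = 2^(-1/2) D Q], where [Q] has
    orthonormal columns and [D x Q^T] is symmetric positive semidefinite.
    Such a polar factor exists: it maximizes [\tr (Q^T *m (D *m x))]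
    ([polar_exists]).  It is not unique when [x] is degenerate, but [D Q] is,
    because the sign condition on dependencies forces the kernel of
    [D x Q^T] into that of [D] ([polar_ker]).  The comparison of two
    maximizers ([polar_dist]) makes this quantitative, whence the continuity
    of [model] ([cvg_model]).  On pyramids [model x = x] because positive
    semidefinite square roots are unique ([model_fix]).

    The deformation follows two segments, from [x] to
    [D x + (1 - D) (model x)] and from there to [model x].  When [x] is
    degenerate, up to a translation the first segment slides the apex
    straight to the barycenter of the base, and the second makes the base
    regular.  The whole path consists of admissible configurations
    ([path_admissible]): on it a dependency is tested against positive
    semidefinite forms.  All choices commute with the permutations of the
    vertices, and the projection onto unlabelled configurations is open, so
    the deformation descends to a continuous one. *)

Set Implicit Arguments.
Unset Strict Implicit.
Unset Printing Implicit Defensive.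

Import Order.TTheory GRing.Theory Num.Theory.
Import numFieldNormedType.Exports.

Local Open Scope classical_set_scope.
Local Open Scope ring_scope.

(** * Positive semidefinite forms and polar factors *)

Section PositiveSemidefinite.
Context {R : realFieldType}.

Definition psd m (A : 'M[R]_m) := forall w : 'rV[R]_m, 0 <= (w *m A *m w^T) 0 0.

Definition sympsd m (A : 'M[R]_m) := A^T = A /\ psd A.

Lemma sqnorm_ge0 m (u : 'rV[R]_m) : 0 <= (u *m u^T) 0 0.
Proof. by rewrite mxE; apply: sumr_ge0 => i _; rewrite mxE -expr2 sqr_ge0. Qed.

Lemma sympsd1 m : sympsd (1%:M : 'M[R]_m).
Proof.
by split; [rewrite tr_scalar_mx | move=> w; rewrite mulmx1 sqnorm_ge0].
Qed.

Lemma idem_sympsd m (A : 'M[R]_m) : A^T = A -> A *m A = A -> sympsd A.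
Proof.
move=> sA A2; split=> // w.
have -> : w *m A *m w^T = (w *m A) *m (w *m A)^T.
  by rewrite trmx_mul sA mulmxA -[w *m A *m A]mulmxA A2.
exact: sqnorm_ge0.
Qed.

Lemma tr_conj_rows m k (A : 'M[R]_m) (W : 'M[R]_(k, m)) :
  \tr (W *m A *m W^T) = \sum_i (row i W *m A *m (row i W)^T) 0 0.
Proof.
apply: eq_bigr => i _; rewrite -!row_mul !mxE.
by apply: eq_bigr => j _; rewrite !mxE.
Qed.

Lemma psd_tr_ge0 m k (A : 'M[R]_m) (W : 'M[R]_(k, m)) :
  psd A -> 0 <= \tr (W *m A *m W^T).
Proof. by move=> pA; rewrite tr_conj_rows; apply: sumr_ge0 => i _. Qed.

Lemma psd_row_le_tr m k (A : 'M[R]_m) (W : 'M[R]_(k, m)) i : psd A ->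
  (row i W *m A *m (row i W)^T) 0 0 <= \tr (W *m A *m W^T).
Proof.
by move=> pA; rewrite tr_conj_rows (bigD1 i) //= lerDl; apply: sumr_ge0.
Qed.

Lemma form_sym m (A : 'M[R]_m) (u v : 'rV[R]_m) : A^T = A ->
  (u *m A *m v^T) 0 0 = (v *m A *m u^T) 0 0.
Proof.
move=> sA; transitivity ((u *m A *m v^T)^T 0 0); first by rewrite [RHS]mxE.
by rewrite !trmx_mul trmxK sA mulmxA.
Qed.

Lemma form_addZ m (A : 'M[R]_m) (u v : 'rV[R]_m) (t : R) : A^T = A ->
  ((u + t *: v) *m A *m (u + t *: v)^T) 0 0 =
  (u *m A *m u^T) 0 0 + 2 * t * (u *m A *m v^T) 0 0
    + t ^+ 2 * (v *m A *m v^T) 0 0.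
Proof.
move=> sA; pose f (a b : 'rV[R]_m) : R := (a *m A *m b^T) 0 0.
have sym a b : f a b = f b a by exact: form_sym.
have lin w : f (u + t *: v) w = f u w + t * f v w.
  by rewrite /f !mulmxDl -!scalemxAl [LHS]mxE [X in _ + X = _]mxE.
have lin' w : f w (u + t *: v) = f w u + t * f w v by rewrite sym lin !(sym w).
rewrite -!/(f _ _) lin !lin' (sym v u); ring.
Qed.

Lemma psd_CS m (A : 'M[R]_m) (u v : 'rV[R]_m) : sympsd A ->
  (u *m A *m v^T) 0 0 ^+ 2 <= (u *m A *m u^T) 0 0 * (v *m A *m v^T) 0 0.
Proof.
move=> [sA pA]; set a := (u *m A *m u^T) 0 0; set b := (u *m A *m v^T) 0 0.
set c := (v *m A *m v^T) 0 0.
have c0 : 0 <= c := pA v.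
have a0 : 0 <= a := pA u.
have q t : 0 <= a + 2 * t * b + t ^+ 2 * c by rewrite -form_addZ.
have [ce|cn] := eqVneq c 0.
  have [->|bn] := eqVneq b 0; first by rewrite expr0n /= ce mulr0.
  have := q (- (a + 1) / (2 * b)); rewrite ce mulr0 addr0.
  have -> : a + 2 * (- (a + 1) / (2 * b)) * b = - 1 by field.
  by rewrite lerNr oppr0 ler10.
have cp : 0 < c by rewrite lt_neqAle eq_sym cn.
have := q (- b / c).
have -> : a + 2 * (- b / c) * b + (- b / c) ^+ 2 * c = (a * c - b ^+ 2) / c by
  field.
by rewrite pmulr_lge0 ?invr_gt0 // subr_ge0.
Qed.

Lemma dot_delta m (u : 'rV[R]_m) (j : 'I_m) :
  (u *m (delta_mx 0 j : 'rV[R]_m)^T) 0 0 = u 0 j :> R.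
Proof.
rewrite mxE (bigD1 j) //= big1 ?addr0 => [|k /negbTE kj].
  by rewrite !mxE !eqxx mulr1.
by rewrite !mxE kj andbF mulr0.
Qed.

Lemma form_delta m (A : 'M[R]_m) (i j : 'I_m) :
  ((delta_mx 0 i : 'rV[R]_m) *m A *m (delta_mx 0 j : 'rV[R]_m)^T) 0 0 = A i j
    :> R.
Proof. by rewrite dot_delta -rowE mxE. Qed.

Lemma psd_form0 m (A : 'M[R]_m) (w : 'rV[R]_m) : sympsd A ->
  (w *m A *m w^T) 0 0 = 0 -> w *m A = 0.
Proof.
move=> hA w0; apply/rowP => j; rewrite [RHS]mxE.
have := psd_CS w (delta_mx 0 j) hA; rewrite w0 mul0r.
rewrite trmx_delta -colE mxE => h; apply/eqP; rewrite -sqrf_eq0 eq_le h /=.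
exact: sqr_ge0.
Qed.

Lemma sqnorm_eq0 m (u : 'rV[R]_m) : (u *m u^T) 0 0 = 0 -> u = 0.
Proof.
move=> u0; rewrite -[u]mulmx1; apply: psd_form0; first exact: sympsd1.
by rewrite mulmx1.
Qed.

Lemma psd_tr0 m k (A : 'M[R]_m) (W : 'M[R]_(k, m)) : sympsd A ->
  \tr (W *m A *m W^T) = 0 -> W *m A = 0.
Proof.
move=> hA t0; apply/row_matrixP => i; rewrite row_mul row0.
apply: psd_form0 => //; apply/eqP; rewrite eq_le (proj2 hA) andbT -t0.
exact: psd_row_le_tr (proj2 hA).
Qed.

(** With [Z := A - B], the equality of the squares makes the traces of
    [Z A Z] and [Z B Z] cancel; both are nonnegative, so [Z] kills [A] and
    [B], hence [Z *m Z = 0]. *)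
Lemma psd_sqrt_uniq m (A B : 'M[R]_m) : sympsd A -> sympsd B ->
  A *m A = B *m B -> A = B.
Proof.
move=> hA hB e; have [[sA pA] [sB pB]] := (hA, hB).
pose Z := A - B; have ZT : Z^T = Z by rewrite /Z linearB /= sA sB.
have t0 : \tr (Z *m A *m Z^T) + \tr (Z *m B *m Z^T) = 0.
  rewrite ZT /Z !(mulmxBl, mulmxBr) !raddfB /= -!mulmxA.
  have -> : A *m (A *m B) = B *m (B *m B) by rewrite mulmxA e -mulmxA.
  have -> : B *m (B *m A) = A *m (A *m A) by rewrite mulmxA -e -mulmxA.
  have -> : \tr (B *m (A *m B)) = \tr (A *m (B *m B)).
    by rewrite mxtrace_mulC -mulmxA.
  have -> : \tr (A *m (B *m A)) = \tr (B *m (A *m A)).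
    by rewrite mxtrace_mulC -mulmxA.
  rewrite -[X in \tr (A *m X)]e [X in \tr (B *m X)]e; ring.
have g1 := psd_tr_ge0 Z pA; have g2 := psd_tr_ge0 Z pB.
have z1 : Z *m A = 0 by apply: psd_tr0 => //; lra.
have z2 : Z *m B = 0 by apply: psd_tr0 => //; lra.
have zz : Z *m Z = 0 by rewrite {2}/Z mulmxBr z1 z2 subr0.
apply/eqP; rewrite -subr_eq0 -/Z; apply/eqP.
rewrite -[Z]mulmx1; apply: psd_tr0; first exact: sympsd1.
by rewrite mulmx1 ZT zz mxtrace0.
Qed.

Lemma ker_factor m p (T : 'M[R]_m) (D : 'M[R]_(m, p)) : T^T = T ->
  (forall w : 'rV[R]_m, w *m T = 0 -> w *m D = 0) -> exists E, D = T *m E.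
Proof.
move=> sT h; have : (D^T <= T)%MS.
  rewrite submxE; apply/eqP; apply: trmx_inj; rewrite trmx_mul trmxK trmx0.
  apply/row_matrixP => i; rewrite row_mul row0; apply: h.
  by rewrite -row_mul -{2}sT -trmx_mul mulmx_coker trmx0 row0.
by move=> /submxP[E e]; exists E^T; rewrite -{1}sT -trmx_mul -e trmxK.
Qed.

End PositiveSemidefinite.

Section Polar.
Context {R : realFieldType}.

Lemma orthonormal_entry_le1 N n (Q : 'M[R]_(N, n)) i j :
  Q^T *m Q = 1%:M -> `|Q i j| <= 1.
Proof.
move=> oQ; rewrite -(@expr_le1 _ 2) // real_normK ?num_real //.
have := congr1 (fun B : 'M[R]_n => B j j) oQ.
rewrite mxE [RHS]mxE eqxx mulr1n => <-.
rewrite (bigD1 i) //= mxE -expr2 lerDl.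
by apply: sumr_ge0 => k _; rewrite mxE -expr2 sqr_ge0.
Qed.

(** [Q] is the isometric part of a polar decomposition [Y = T *m Q], with
    [T := Y *m Q^T] positive semidefinite.  [Y] may be rank deficient, in
    which case [Q] is not determined by [Y]. *)
Definition polar N n (Y Q : 'M[R]_(N, n)) :=
  Q^T *m Q = 1%:M /\ sympsd (Y *m Q^T).

Section Facts.
Variables (N n : nat) (Y Q : 'M[R]_(N, n)).
Hypothesis pol : polar Y Q.
Local Notation T := (Y *m Q^T).

Lemma polar_mulQ : T *m Q = Y.
Proof. by rewrite -mulmxA (proj1 pol) mulmx1. Qed.

Lemma polar_absorb : T *m (Q *m Q^T) = T.
Proof. by rewrite mulmxA polar_mulQ. Qed.

(** [Q] maximizes the trace of [Q^T *m Y] over orthonormal frames, with a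
    gap that is quadratic in the distance measured by [T].  It comes from
    [\tr (T *m (1 - Q' *m Q'^T)) >= 0], the second factor being a
    projection. *)
Lemma polar_compare (Q' : 'M[R]_(N, n)) : Q'^T *m Q' = 1%:M ->
  \tr ((Q - Q')^T *m T *m (Q - Q')) <= 2 * \tr ((Q - Q')^T *m Y).
Proof.
move=> o; have [sT pT] := proj2 pol; have TQ := polar_mulQ.
have TQQ := polar_absorb; move: sT pT TQ TQQ; move: T => t sT pT TQ TQQ.
pose P := 1%:M - Q' *m Q'^T.
have PT : P^T = P by rewrite /P linearB /= tr_scalar_mx trmx_mul trmxK.
have PP : P *m P = P.
  rewrite {2}/P mulmxBr mulmx1 {2}/P mulmxA mulmxBl mul1mx -[_ *m Q']mulmxA o.
  by rewrite mulmx1 subrr mul0mx subr0.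
have t1 : \tr (Q'^T *m t *m Q') <= \tr t.
  rewrite mxtrace_mulC -subr_ge0 mulmxA.
  have -> : \tr t - \tr (Q' *m Q'^T *m t) = \tr (P *m t).
    by rewrite /P mulmxBl mul1mx raddfB.
  by rewrite -PP -mulmxA mxtrace_mulC -{2}PT psd_tr_ge0.
have t2 : \tr (Q^T *m t *m Q) = \tr t.
  by rewrite mxtrace_mulC mulmxA mxtrace_mulC TQQ.
have t3 : \tr (Q^T *m t *m Q') = \tr (Q'^T *m t *m Q).
  by rewrite -mxtrace_tr !trmx_mul trmxK sT mulmxA.
rewrite -TQ mulmxA [(Q - Q')^T]linearB /= !mulmxBl !mulmxBr !raddfB /= t3 t2.
lra.
Qed.

End Facts.

(** Adding the two comparisons makes the traces of [Y] and [Y'] meet in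
    [Y - Y']: in the seminorm of [T], a polar factor depends continuously on
    the matrix, even where it is not unique. *)
Lemma polar_dist N n (Y Q Y' Q' : 'M[R]_(N, n)) : polar Y Q -> polar Y' Q' ->
  \tr ((Q - Q')^T *m (Y *m Q^T) *m (Q - Q')) <=
    2 * \tr ((Q - Q')^T *m (Y - Y')).
Proof.
move=> h h'; have a := polar_compare h (proj1 h').
have b := polar_compare h' (proj1 h).
have := psd_tr_ge0 (Q' - Q)^T (proj2 (proj2 h')); rewrite trmxK => c.
rewrite mulmxBr raddfB /=.
have := le_trans c b; rewrite -[Q' - Q]opprB linearN mulNmx raddfN /=; lra.
Qed.

Lemma polar_uniq N n p (Y Q Q' : 'M[R]_(N, n)) (D : 'M[R]_(p, N)) :
  polar Y Q -> polar Y Q' ->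
  (forall w : 'rV[R]_N, w *m (Y *m Q^T) = 0 -> w *m D^T = 0) ->
  D *m Q = D *m Q'.
Proof.
move=> h h' ker; have [sT pT] := proj2 h.
have := polar_dist h h'; rewrite subrr mulmx0 mxtrace0 mulr0 => le0.
have z : (Q - Q')^T *m (Y *m Q^T) = 0.
  apply: psd_tr0 => //; apply/eqP; rewrite eq_le psd_tr_ge0 // andbT trmxK //.
have : (Q - Q')^T *m D^T = 0.
  apply/row_matrixP => i; rewrite row_mul row0; apply: ker.
  by rewrite -row_mul z row0.
move=> /(congr1 trmx); rewrite trmx_mul !trmxK trmx0 mulmxBr => /eqP.
by rewrite subr_eq0 => /eqP.
Qed.

End Polar.

Section MatrixLimits.
Context {R : realType} {T : Type} {F : set_system T} {FF : Filter F}.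

(** Limits along an arbitrary filter serve both on matrices and on the
    product of the time line with the space of embeddings. *)
Lemma cvg_mx m n (f : T -> 'M[R]_(m, n)) (a : 'M[R]_(m, n)) :
  (forall i j, f x i j @[x --> F] --> a i j) -> f x @[x --> F] --> a.
Proof.
move=> h; apply/cvg_ballP => e e0.
have : \forall x \near F, forall ij : 'I_m * 'I_n,
    ball (a ij.1 ij.2) e (f x ij.1 ij.2).
  by apply: filter_forall => ij; exact: (cvg_ballP _ _).1 (h _ _) _ e0.
by apply: filterS => x hx; split=> // i j; exact: hx (i, j).
Qed.

Lemma cvg_entry m n (f : T -> 'M[R]_(m, n)) (a : 'M[R]_(m, n)) i j :
  f x @[x --> F] --> a -> f x i j @[x --> F] --> a i j.
Proof.
by move=> h; apply: (@cvg_comp _ _ _ f (fun M : 'M[R]_(m, n) => M i j) F _ _ h);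
  exact: coord_continuous.
Qed.

Lemma cvg_sumr (I : Type) (r : seq I) (P : pred I) (f : I -> T -> R)
    (a : I -> R) : (forall i, P i -> f i x @[x --> F] --> a i) ->
  \sum_(i <- r | P i) f i x @[x --> F] --> \sum_(i <- r | P i) a i.
Proof. by move=> h; apply: cvg_big => //; exact: add_continuous. Qed.

Lemma cvg_prodr (I : Type) (r : seq I) (P : pred I) (f : I -> T -> R)
    (a : I -> R) : (forall i, P i -> f i x @[x --> F] --> a i) ->
  \prod_(i <- r | P i) f i x @[x --> F] --> \prod_(i <- r | P i) a i.
Proof. by move=> h; apply: cvg_big => //; exact: mul_continuous. Qed.

Lemma cvg_mulmx m n p (f : T -> 'M[R]_(m, n)) (g : T -> 'M[R]_(n, p))
    (a : 'M[R]_(m, n)) (b : 'M[R]_(n, p)) :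
  f x @[x --> F] --> a -> g x @[x --> F] --> b ->
  f x *m g x @[x --> F] --> a *m b.
Proof.
move=> hf hg; apply: cvg_mx => i j.
under eq_fun do rewrite mxE.
rewrite mxE; apply: cvg_sumr => k _.
by apply: cvgM; apply: cvg_entry.
Qed.

Lemma cvg_det m (f : T -> 'M[R]_m) (a : 'M[R]_m) :
  f x @[x --> F] --> a -> \det (f x) @[x --> F] --> \det a.
Proof.
move=> h; apply: cvg_sumr => s _; apply: cvgM; first exact: cvg_cst.
by apply: cvg_prodr => i _; apply: cvg_entry.
Qed.

End MatrixLimits.

Section PolarExistence.
Context {R : realType}.

(** A maximizer of [\tr (Q^T *m Y)] over the compact set of orthonormal
    frames is a polar factor: multiplying [Q] by orthogonal matrices cannot
    increase the trace.  Reflections yield positivity of [Y *m Q^T], and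
    products of two nearby reflections yield its symmetry. *)
Lemma polar_exists N n (Y : 'M[R]_(N, n)) : (n <= N)%N -> exists Q, polar Y Q.
Proof.
move=> nN.
pose A := [set v : 'rV[R]_(N * n) | (vec_mx v)^T *m vec_mx v = (1%:M :
  'M[R]_n)].
pose f (v : 'rV[R]_(N * n)) := \tr ((vec_mx v)^T *m Y).
have vc (v : 'rV[R]_(N * n)) :
    (vec_mx u : 'M[R]_(N, n)) @[u --> v] --> (vec_mx v : 'M[R]_(N, n)).
  apply: (@cvg_mx _ _ (nbhs v) _) => i j; under eq_fun do rewrite mxE.
  by rewrite mxE; apply: coord_continuous.
have vtc (v : 'rV[R]_(N * n)) :
    (vec_mx u : 'M[R]_(N, n))^T @[u --> v] --> (vec_mx v : 'M[R]_(N, n))^T.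
  apply: (@cvg_mx _ _ (nbhs v) _) => i j; under eq_fun do rewrite mxE.
  by rewrite mxE; apply: (@cvg_entry _ _ (nbhs v) _); exact: vc.
have A0 : A !=set0.
  exists (mxvec (pid_mx n)); rewrite /A /= mxvecK tr_pid_mx mul_pid_mx.
  by rewrite minnn (minn_idPr nN) pid_mx_1.
have Acl : closed A.
  have -> : A = (fun v => (vec_mx v : 'M[R]_(N, n))^T *m vec_mx v) @^-1`
     [set (1%:M : 'M[R]_n)] by [].
  apply: preimage_closed; last first.
    exact: (accessible_closed_set1 (hausdorff_accessible (@norm_hausdorff _
      'M[R]_n))).
  by move=> v _; apply: (@cvg_mulmx _ _ (nbhs v) _); [exact: vtc | exact: vc].
have Abd : bounded_set A.
  exists 1; split; first exact: num_real.
  move=> M M1 v /= Av; rewrite /Num.norm /= mx_normrE.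
  apply/bigmax_leP; split=> [|[i0 k] _ /=]; first by rewrite (le_trans _ (ltW
    M1)).
  apply: le_trans (ltW M1); case/mxvec_indexP: k => i j.
  by rewrite (ord1 i0) -[v]vec_mxK mxvecE; exact: orthonormal_entry_le1.
have fc : {within A, continuous f}.
  apply: continuous_subspaceT => v; apply: (@cvg_sumr _ _ (nbhs v) _) => i _.
  by apply: (@cvg_entry _ _ (nbhs v) _); apply: (@cvg_mulmx _ _ (nbhs v) _);
    [exact: vtc | exact: cvg_cst].
have [c cA cmax] := compact_EVT_max A0 (bounded_closed_compact Abd Acl) fc.
pose Q : 'M[R]_(N, n) := vec_mx c.
have oQ : Q^T *m Q = 1%:M by rewrite inE in cA.
have maxQ (Q' : 'M[R]_(N, n)) : Q'^T *m Q' = 1%:M ->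
    \tr (Q'^T *m Y) <= \tr (Q^T *m Y).
  move=> o; have := cmax (mxvec Q'); rewrite inE /A /f /= mxvecK => h.
  exact: h.
exists Q; split=> //.
pose t := Y *m Q^T.
have maxO (O : 'M[R]_N) : O^T *m O = 1%:M -> \tr (O^T *m t) <= \tr t.
  move=> o; have := maxQ (O *m Q).
  rewrite trmx_mul mulmxA -[_ *m O^T *m O]mulmxA o mulmx1 => /(_ oQ).
  by rewrite -mulmxA mxtrace_mulC -mulmxA [X in _ <= X]mxtrace_mulC.
(* [H w] is the reflection in the hyperplane orthogonal to [w]. *)
pose r (w : 'rV[R]_N) : R := (w *m w^T) 0 0.
pose H (w : 'rV[R]_N) : 'M[R]_N := 1%:M - (2 / r w) *: (w^T *m w).
have wwE (w : 'rV[R]_N) : w *m w^T = (r w)%:M by rewrite [LHS]mx11_scalar.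
have HT w : (H w)^T = H w.
  by rewrite /H linearB linearZ /= tr_scalar_mx trmx_mul trmxK.
have wP (w : 'rV[R]_N) : (w^T *m w) *m (w^T *m w) = r w *: (w^T *m w).
  by rewrite mulmxA -[w^T *m w *m w^T]mulmxA wwE mul_mx_scalar -scalemxAl.
have HH w : r w != 0 -> H w *m H w = 1%:M.
  move=> w0; rewrite /H mulmxBl mul1mx mulmxBr mulmx1 -scalemxAl -scalemxAr.
  rewrite wP !scalerA; have -> : 2 / r w * (2 / r w) * r w = 2 / r w + 2 / r w.
    by field.
  by rewrite scalerDl opprB addrK subrK.
have r_ge0 w : 0 <= r w := sqnorm_ge0 w.
pose q (u v : 'rV[R]_N) : R := (u *m t *m v^T) 0 0.
have trq (u v : 'rV[R]_N) : \tr (v^T *m u *m t) = q u v.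
  by rewrite -mulmxA mxtrace_mulC trace_mx11.
have pt : psd t.
  move=> w; have [w0|w0] := eqVneq (r w) 0.
    suff -> : w = 0 by rewrite !mul0mx mxE.
    exact: sqnorm_eq0.
  have := maxO (H w); rewrite HT HH // => /(_ erefl).
  rewrite /H mulmxBl mul1mx -scalemxAl raddfB /= linearZ /= trq.
  have : 0 < 2 / r w by rewrite divr_gt0 // lt_neqAle eq_sym w0 r_ge0.
  by move=> c0; rewrite lerBlDr lerDl pmulr_rge0.
split=> //; apply/matrixP => j i; rewrite mxE.
have [-> //|ij] := eqVneq i j.
pose z : 'rV[R]_N := delta_mx 0 i; pose y : 'rV[R]_N := delta_mx 0 j.
have qE (a b : 'I_N) : q (delta_mx 0 a) (delta_mx 0 b) = t a b.
  exact: form_delta.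
have dd (a b : 'I_N) : ((delta_mx 0 a : 'rV[R]_N) *m (delta_mx 0 b :
  'rV[R]_N)^T) 0 0 = (a == b)%:R.
  by rewrite dot_delta !mxE eqxx eq_sym.
(* For small e of the sign of the difference of the two entries, this
   forces the difference to vanish. *)
suff key e : e * (t j i - t i j) <= e ^+ 2 * (t i i + t j j).
  have s0 : 0 <= t i i + t j j by rewrite addr_ge0 // -qE; exact: pt.
  set d := t j i - t i j in key; set s := t i i + t j j in key s0.
  suff : d ^+ 2 <= 0.
    rewrite le_eqVlt ltNge sqr_ge0 orbF sqrf_eq0 subr_eq0 => /eqP e.
    by rewrite -/t e.
  have := key (d / (s + 1)); have s1 : 0 < s + 1 by rewrite ltr_wpDl.
  rewrite expr_div_n -subr_ge0.
  have -> : d ^+ 2 / (s + 1) ^+ 2 * s - d / (s + 1) * d =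
      - d ^+ 2 / (s + 1) ^+ 2.
    by field; rewrite gt_eqF.
  by rewrite pmulr_lge0 ?invr_gt0 ?exprn_gt0 // oppr_ge0.
(* The rotation is the product of the reflections along [z] and along a
   vector at distance e from it. *)
pose w := z + e *: y.
have qD u v u' a : q (u + a *: v) u' = q u u' + a * q v u'.
  by rewrite /q !mulmxDl -!scalemxAl [LHS]mxE [X in _ + X = _]mxE.
have qD' u v u' a : q u' (u + a *: v) = q u' u + a * q u' v.
  by rewrite /q linearD linearZ /= mulmxDr -scalemxAr [LHS]mxE [X in _ + X =
    _]mxE.
have rw : r w = 1 + e ^+ 2.
  rewrite /r /w linearD linearZ /= mulmxDl !mulmxDr -!scalemxAl -!scalemxAr.
  have me (B C : 'M[R]_1) : (B + C) 0 0 = B 0 0 + C 0 0 by rewrite mxE.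
  have mz a (B : 'M[R]_1) : (a *: B) 0 0 = a * B 0 0 by rewrite mxE.
  rewrite !(me, mz) !dd !eqxx [j == i]eq_sym (negbTE ij) /=; ring.
have rz : r z = 1 by rewrite /r dd eqxx.
have zw : (z *m w^T) 0 0 = 1.
  rewrite /w linearD linearZ /= mulmxDr -scalemxAr mxE dd eqxx mxE dd (negbTE
    ij).
  by rewrite mulr0 addr0.
have e0 : 0 < 1 + e ^+ 2 by rewrite ltr_wpDr ?sqr_ge0.
have := maxO (H w *m H z).
rewrite trmx_mul !HT mulmxA -[_ *m H w *m H w]mulmxA HH ?rw ?gt_eqF // mulmx1.
rewrite HH ?rz ?oner_eq0 // => /(_ erefl).
have -> : \tr (H z *m H w *m t) =
    \tr t - 2 * q z z - 2 / (1 + e ^+ 2) * q w w + 2 * (2 / (1 + e ^+ 2)) * q w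
      z.
  have zzww : (z^T *m z) *m (w^T *m w) = z^T *m w.
    by rewrite mulmxA -[z^T *m z *m w^T]mulmxA [z *m w^T]mx11_scalar zw mulmx1.
  rewrite /H rw rz divr1 [(1%:M - _) *m (1%:M - _)]mulmxBl mul1mx mulmxBr
    mulmx1.
  rewrite -scalemxAl -scalemxAr zzww !mulmxBl mul1mx -!scalemxAl.
  have trN (B : 'M[R]_N) : \tr (- B) = - \tr B by exact: raddfN.
  rewrite !(mxtraceD, trN, mxtraceZ, trq); ring.
rewrite -subr_ge0.
have -> : \tr t - (\tr t - 2 * q z z - 2 / (1 + e ^+ 2) * q w w
    + 2 * (2 / (1 + e ^+ 2)) * q w z)
  = 2 / (1 + e ^+ 2) * ((1 + e ^+ 2) * q z z + q w w - 2 * q w z).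
  by field; rewrite gt_eqF.
rewrite pmulr_rge0 ?divr_gt0 // /w !(qD, qD') /z /y !qE => h; lra.
Qed.

End PolarExistence.

(** * Linear embeddings of the codimension 2 skeleton *)

Lemma other_vertex n (i : 'I_n.+1) : (0 < n)%N -> exists j, j != i.
Proof.
move=> n0; have [i0|i0] := eqVneq i ord0; last by exists ord0; rewrite eq_sym.
by exists ord_max; rewrite i0 -val_eqE /= -lt0n.
Qed.

Section AffineMaps.
Context {R : realType}.

(** [affine_on] only speaks of segments; peeling off one vertex of the
    support at a time gives all barycentric combinations. *)
Lemma affine_barycentric m N (s : {set 'I_N}) (f : 'rV[R]_N -> 'rV[R]_m) t :
  affine_on (simplex s) f -> simplex s t ->
  f t = \sum_i t 0 i *: f (delta_mx 0 i).
Proof.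
move=> af; pose supp (u : 'rV[R]_N) := [set i | u 0 i != 0]%SET.
have [k] := ubnP #|supp t|; elim: k t => // k IH t.
rewrite ltnS => tk [t0 t1 ts].
have [i ti] : exists i, t 0 i != 0.
  apply: contrapT => /forallNP h; move/eqP: t1.
  rewrite big1 ?(eq_sym 0) ?oner_eq0 // => i _.
  by apply/eqP; apply: contraT => /h.
have is_ : i \in s by apply: contraNT ti => /ts ->.
have di : simplex s (delta_mx 0 i : 'rV[R]_N).
  split=> [j||j js]; first by rewrite mxE ler0n.
    rewrite (bigD1 i) //= mxE !eqxx big1 ?addr0 // => j /negbTE ji.
    by rewrite mxE ji andbF.
  have [e|ji] := eqVneq j i; first by rewrite -e (negbTE js) in is_.
  by rewrite mxE (negbTE ji) andbF.
have sumE : t 0 i + \sum_(j | j != i) t 0 j = 1 by rewrite -t1 [RHS](bigD1 i).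
have s_ge0 : 0 <= \sum_(j | j != i) t 0 j by apply: sumr_ge0 => j _; exact: t0.
have [ti1|ti1] := eqVneq (t 0 i) 1.
  have te : t = delta_mx 0 i.
    apply/rowP => j; rewrite mxE eqxx /=; have [->//|ji] := eqVneq j i.
    have s0 : \sum_(j | j != i) t 0 j = 0 by move: sumE; rewrite ti1; lra.
    by move/psumr_eq0P : s0 => -> // l _; exact: t0.
  rewrite te (bigD1 i) //= mxE !eqxx scale1r big1 ?addr0 // => j /negbTE ji.
  by rewrite mxE ji andbF scale0r.
have u0 : 0 < 1 - t 0 i by rewrite lt_neqAle eq_sym subr_eq0 eq_sym ti1 /=; lra.
pose t' := (1 - t 0 i)^-1 *: (t - t 0 i *: delta_mx 0 i).
have t'E j : t' 0 j = if j == i then 0 else (1 - t 0 i)^-1 * t 0 j.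
  by rewrite !mxE eqxx /=; case: eqP => [->|_] /=;
    rewrite ?mulr1 ?mulr0 ?subrr ?subr0 ?mulr0.
have st' : simplex s t'.
  split=> [j||j js].
  - by rewrite t'E; case: ifP => // _; rewrite mulr_ge0 ?t0 // invr_ge0 ltW.
  - rewrite (bigD1 i) //= t'E eqxx add0r.
    under eq_bigr => j ji do rewrite t'E (negbTE ji).
    rewrite -mulr_sumr; have -> : \sum_(j | j != i) t 0 j = 1 - t 0 i by lra.
    by rewrite mulVf // gt_eqF.
  - by rewrite t'E (ts j js) mulr0; case: ifP.
have te : t = t 0 i *: delta_mx 0 i + (1 - t 0 i) *: t'.
  by rewrite scalerA mulfV ?gt_eqF // scale1r addrC subrK.
have lt' : (#|supp t'| < k)%N.
  apply: leq_trans tk; apply: proper_card; apply/properP; split.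
    apply/fintype.subsetP => j; rewrite !inE t'E; case: ifP => [_|_];
      first by rewrite eqxx.
    by apply: contraNneq => ->; rewrite mulr0.
  by exists i; rewrite !inE ?t'E ?eqxx.
rewrite {1}te af //; last by rewrite t0 /=; lra.
rewrite (IH t') // [in RHS](bigD1 i) //=; congr (_ + _).
rewrite (bigD1 i) //= t'E eqxx scale0r add0r scaler_sumr.
apply: eq_bigr => j ji; rewrite t'E (negbTE ji) scalerA mulrA mulfV ?mul1r //.
by rewrite gt_eqF.
Qed.

End AffineMaps.

Section Dependencies.
Context {R : realType} {n : nat}.
Implicit Types (x : 'M[R]_(n.+1, n)) (c : 'rV[R]_n.+1) (a i : 'I_n.+1).

Definition dependency x c := c *m x = 0 /\ \sum_i c 0 i = 0.

(** The sign pattern of a dependency that expresses the vertex [a] as a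
    convex combination of all the others, with positive coefficients. *)
Definition apical c a := forall i, i != a -> c 0 i * c 0 a < 0.

Definition admissible x := forall c, dependency x c -> c != 0 -> exists a,
  apical c a.

(** Any n of the n+1 vertices are affinely independent. *)
Lemma admissible_zero_entry x c i : (0 < n)%N ->
  admissible x -> dependency x c -> c 0 i = 0 -> c = 0.
Proof.
move=> n0 gx dc ci; apply/eqP; apply: contraT => /(gx _ dc)[a ha].
have [e|ia] := eqVneq i a; last by have := ha i ia; rewrite ci mul0r ltxx.
have [j ja] := other_vertex a n0.
by have := ha j ja; rewrite -e ci mulr0 ltxx.
Qed.

(** Two points of the realization with the same image differ, up to scaling,
    by a dependency, whose positive and negative parts are carried by their
    faces.  The faces have at most n-1 vertices, so a collision exists unless
    the positive or the negative part has n of the n+1 vertices. *)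
Lemma embeddings_admissible x : (2 <= n)%N ->
  embeddings (skeleton n.+1 (n - 2)) x <-> admissible x.
Proof.
move=> n2; have n1 : (n - 2).+1 = n.-1 by case: n n2 => [|[|m]] //= _;
  rewrite subn2.
have n3 : n.-1.+1 = n by rewrite prednK // ltnW.
split=> [[f [inj aff] fx] c [cx c1] c0|gx].
- have rep s t : s \in skeleton n.+1 (n - 2) -> simplex s t -> f t = t *m x.
    move=> sK st; rewrite (affine_barycentric (aff s sK) st) mulmx_sum_row.
    by apply: eq_bigr => i _; rewrite fx.
  pose P := [set i | 0 < c 0 i]%SET; pose Q := [set i | c 0 i < 0]%SET.
  (* The positive and negative parts of [c] have the same sum [m]. *)
  pose p : 'rV[R]_n.+1 := \row_i Num.max (c 0 i) 0.
  pose q : 'rV[R]_n.+1 := \row_i Num.max (- c 0 i) 0.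
  have p0 i : 0 <= p 0 i by rewrite mxE le_max lexx orbT.
  have q0 i : 0 <= q 0 i by rewrite mxE le_max lexx orbT.
  have pq i : c 0 i = p 0 i - q 0 i.
    rewrite !mxE; have /orP[h|h] := le_total 0 (c 0 i).
      by rewrite max_l // max_r ?oppr_le0 // subr0.
    by rewrite max_r // max_l ?oppr_ge0 // sub0r opprK.
  have cpq : c = p - q by apply/rowP => i; rewrite [RHS]mxE [X in _ = _ + X]mxE
    pq.
  pose m := \sum_i p 0 i.
  have mq : \sum_i q 0 i = m.
    apply/eqP; rewrite eq_sym -subr_eq0 -sumrB -[X in _ == X]c1; apply/eqP.
    by apply: eq_bigr => i _; rewrite pq.
  have m0 : m != 0.
    apply: contraNneq c0 => m0; apply/eqP/rowP => i; rewrite mxE pq.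
    have /psumr_eq0P -> // : \sum_i p 0 i = 0 by [].
    have /psumr_eq0P -> // : \sum_i q 0 i = 0 by rewrite mq.
    by rewrite subrr.
  have mp : 0 < m by rewrite lt_neqAle eq_sym m0 sumr_ge0.
  have sP : simplex P (m^-1 *: p).
    split=> [i||i]; first by rewrite mxE mulr_ge0 ?invr_ge0 // ltW.
      by under eq_bigr do rewrite mxE; rewrite -mulr_sumr mulVf.
    by rewrite inE -leNgt !mxE => /max_r ->; rewrite mulr0.
  have sQ : simplex Q (m^-1 *: q).
    split=> [i||i]; first by rewrite mxE mulr_ge0 ?invr_ge0 // ltW.
      by under eq_bigr do rewrite mxE; rewrite -mulr_sumr mq mulVf.
    by rewrite inE -leNgt !mxE -oppr_le0 => /max_r ->; rewrite mulr0.
  have ne (S : {set 'I_n.+1}) (t : 'rV[R]_n.+1) : simplex S t -> exists a,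
    a \in S.
    move=> [_ t1 tS]; apply: contrapT => /forallNP h; move/eqP: t1.
    by rewrite big1 ?(eq_sym 0) ?oner_eq0 // => i _; apply: tS; apply/negP/h.
  have inK (S : {set 'I_n.+1}) (t : 'rV[R]_n.+1) : simplex S t ->
    ~~ (n <= #|S|)%N ->
      S \in skeleton n.+1 (n - 2).
    move=> /ne[a aS]; rewrite -ltnNge => h; rewrite inE n1.
    by apply/andP; split; [apply/set0Pn; exists a | rewrite -ltnS n3].
  have apex (S : {set 'I_n.+1}) a : (n <= #|S|)%N -> a \notin S ->
      forall i, i != a -> i \in S.
    move=> nS aS i ia; apply: contraT => iS.
    have : (#|[set a; i]%SET| <= #|~: S|%SET)%N.
      by apply: subset_leq_card; apply/fintype.subsetP => j;
        rewrite !inE => /orP[] /eqP ->.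
    rewrite cards2 eq_sym ia; have := cardsC S; rewrite card_ord; lia.
  have [nP|nP] := boolP (n <= #|P|)%N.
    have [a aQ] := ne _ _ sQ; exists a => i ia; move: aQ; rewrite inE => ca.
    have := apex _ a nP _ i ia; rewrite !inE -leNgt ltW // => /(_ isT) ci.
    by rewrite pmulr_rlt0.
  have [nQ|nQ] := boolP (n <= #|Q|)%N.
    have [a aP] := ne _ _ sP; exists a => i ia; move: aP; rewrite inE => ca.
    have := apex _ a nQ _ i ia; rewrite !inE -leNgt ltW // => /(_ isT) ci.
    by rewrite nmulr_rlt0.
  have := inj (m^-1 *: p) (m^-1 *: q).
  rewrite !inE => /(_ _ _ _) e.
  move: c0; rewrite cpq subr_eq0 => /eqP; case.
  apply: (scalerI (invr_neq0 m0)); apply: e.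
  - by exists P => //; exact: inK sP nP.
  - by exists Q => //; exact: inK sQ nQ.
  - rewrite (rep _ _ (inK _ _ sP nP) sP) (rep _ _ (inK _ _ sQ nQ) sQ).
    rewrite -!scalemxAl; congr (_ *: _); apply/eqP.
    by rewrite -subr_eq0 -mulmxBl -cpq cx.
- exists (fun t => t *m x) => [|i]; last by rewrite rowE.
  split=> [p q|s _ p q l _ _ _]; last by rewrite mulmxDl -!scalemxAl.
  rewrite !inE => -[s sK [p0 p1 ps]] [s' s'K [q0 q1 qs]] pq.
  apply/eqP; rewrite -subr_eq0; apply: contraT => d0.
  have [|a ha] := gx (p - q) _ d0.
    split; first by rewrite mulmxBl pq subrr.
    by under eq_bigr do rewrite !mxE; rewrite sumrB p1 q1 subrr.
  have full (S : {set 'I_n.+1}) (t : 'rV[R]_n.+1) :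
      S \in skeleton n.+1 (n - 2) -> (forall i, i \notin S -> t 0 i = 0) ->
      ~ (forall i, i != a -> 0 < t 0 i).
    rewrite inE n1 => /andP[_ cS] tS h.
    have : (#|~: [set a]%SET|%SET <= #|S|)%N.
      apply: subset_leq_card; apply/fintype.subsetP => i; rewrite !inE => ia.
      by apply: contraT => /tS e; have := h i ia; rewrite e ltxx.
    rewrite cardsC1 card_ord /= => h'; have := leq_trans h' cS;
      rewrite -ltnS n3.
    by rewrite ltnn.
  have aa : (p - q) 0 a != 0.
    have [j /ha] := other_vertex a (ltnW n2).
    by apply: contraTneq => ->; rewrite mulr0 ltxx.
  have [neg|pos] := ltP ((p - q) 0 a) 0.
    exfalso; apply: (full s p sK ps) => i /ha; rewrite nmulr_llt0 // !mxE.
    by have := q0 i; lra.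
  exfalso; apply: (full s' q s'K qs) => i /ha.
  by rewrite pmulr_llt0 ?lt_neqAle 1?eq_sym ?aa // !mxE; have := p0 i; lra.
Qed.

End Dependencies.

(** * Shrinking one direction of the space of coordinates *)

Section Compress.
Context {R : realType} {n : nat}.
Hypothesis n0 : (0 < n)%N.
Local Notation N := n.+1.

(** The matrices below act on vectors indexed by the vertices.  They are
    locked because matching a term against one of them would otherwise unfold
    the others. [centering] is the orthogonal projection on the vectors of
    zero sum. *)
Fact centering_key : unit. Proof. by []. Qed.
Definition centering : 'M[R]_N := locked_with centering_key (1%:M - N%:R^-1 *:
  const_mx 1).

(** The orthogonal projection on the line of the centred basis vector of
    [a]; the factor normalizes its squared length, n/(n+1). *)
Fact axis_key : unit. Proof. by []. Qed.
Definition axis (a : 'I_N) : 'M[R]_N :=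
  locked_with axis_key ((N%:R / n%:R) *: (centering *m delta_mx a a *m
    centering)).

Fact compress_key : unit. Proof. by []. Qed.
Definition compress (a : 'I_N) (k : R) : 'M[R]_N :=
  locked_with compress_key (centering - (1 - k) *: axis a).

Lemma centering_def : centering = 1%:M - N%:R^-1 *: const_mx 1.
Proof. exact: (locked_withE centering_key). Qed.

Lemma axis_def a :
  axis a = (N%:R / n%:R) *: (centering *m delta_mx a a *m centering).
Proof. exact: (locked_withE axis_key). Qed.

Lemma compress_def a k : compress a k = centering - (1 - k) *: axis a.
Proof. exact: (locked_withE compress_key). Qed.

Let nR : n%:R != 0 :> R. Proof. by rewrite pnatr_eq0 -lt0n. Qed.
Let NR : N%:R != 0 :> R. Proof. by rewrite pnatr_eq0. Qed.

Lemma mulmx_const1 m (c : 'M[R]_(m, N)) i j :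
  (c *m (const_mx 1 : 'M[R]_N)) i j = \sum_k c i k.
Proof. by rewrite mxE; apply: eq_bigr => k _; rewrite mxE mulr1. Qed.

Lemma centering_tr : centering^T = centering.
Proof. by rewrite centering_def linearB linearZ /= tr_scalar_mx trmx_const. Qed.

Lemma centering_fix (c : 'rV[R]_N) : \sum_i c 0 i = 0 -> c *m centering = c.
Proof.
move=> c0; rewrite centering_def mulmxBr mulmx1 -scalemxAr.
suff -> : c *m (const_mx 1 : 'M[R]_N) = 0 by rewrite scaler0 subr0.
by apply/rowP => j; rewrite mulmx_const1 c0 mxE.
Qed.

Lemma centering_idem : centering *m centering = centering.
Proof.
rewrite {1}centering_def mulmxBl mul1mx -scalemxAl.
suff -> : (const_mx 1 : 'M[R]_N) *m centering = 0 by rewrite scaler0 subr0.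
rewrite centering_def mulmxBr mulmx1 -scalemxAr; apply/matrixP => i j.
rewrite mxE [X in _ + X]mxE [X in _ - X]mxE mulmx_const1 !mxE.
under eq_bigr do rewrite mxE.
by rewrite sumr_const card_ord mulVf // subrr.
Qed.

Lemma centering_sum (c : 'rV[R]_N) : \sum_i (c *m centering) 0 i = 0.
Proof.
rewrite centering_def mulmxBr mulmx1 -scalemxAr.
under eq_bigr do rewrite mxE [X in _ + X]mxE [X in _ - X]mxE mulmx_const1.
by rewrite sumrB sumr_const card_ord -[(_ * _) *+ _]mulr_natl mulrA mulfV //
  mul1r subrr.
Qed.

Lemma centeringE i j : centering i j = (i == j)%:R - N%:R^-1.
Proof. by rewrite centering_def !mxE mulr1. Qed.

Lemma axisE a i j :
  axis a i j = N%:R / n%:R * (centering i a * centering a j).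
Proof.
rewrite axis_def mxE; congr (_ * _); rewrite mxE (bigD1 a) //= big1 ?addr0.
  rewrite mxE (bigD1 a) //= big1 ?addr0 => [|k /negbTE ka].
    by rewrite [delta_mx _ _ _ _]mxE !eqxx mulr1.
  by rewrite [delta_mx _ _ _ _]mxE ka mulr0.
move=> k /negbTE ka; rewrite mxE big1 ?mul0r // => l _.
by rewrite [delta_mx _ _ _ _]mxE ka andbF mulr0.
Qed.

Lemma axis_tr a : (axis a)^T = axis a.
Proof. by rewrite axis_def linearZ /= !trmx_mul trmx_delta centering_tr mulmxA.
  Qed.

Lemma centering_axis a : centering *m axis a = axis a.
Proof. by rewrite axis_def -scalemxAr !mulmxA centering_idem. Qed.

Lemma axis_centering a : axis a *m centering = axis a.
Proof. by rewrite axis_def -scalemxAl -!mulmxA centering_idem. Qed.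

(** Projecting on the axis keeps the entry at the apex and spreads its
    opposite evenly over the other vertices. *)
Lemma axis_row a (c : 'rV[R]_N) i : \sum_j c 0 j = 0 ->
  (c *m axis a) 0 i = if i == a then c 0 a else - c 0 a / n%:R.
Proof.
move=> c0; have -> : (c *m axis a) 0 i = N%:R / n%:R * (c 0 a * centering a i).
  rewrite mxE; under eq_bigr do rewrite axisE.
  rewrite -{2}(centering_fix c0) [(c *m centering) 0 a]mxE mulr_suml mulr_sumr.
  by apply: eq_bigr => j _; ring.
rewrite centeringE eq_sym; case: eqP => _ /=; rewrite -natr1; field;
  by rewrite ?nR //= -?natr1 ?NR // natr1 NR.
Qed.

Lemma axis_idem a : axis a *m axis a = axis a.
Proof.
apply/row_matrixP => i; rewrite row_mul.
have r0 : \sum_j (row i (axis a)) 0 j = 0.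
  by rewrite -axis_centering row_mul; exact: centering_sum.
apply/rowP => j; rewrite axis_row //.
have r0' : \sum_j (row i centering) 0 j = 0 by rewrite -centering_idem row_mul
  centering_sum.
have e b : (row i (axis a)) 0 b = if b == a then (row i centering) 0 a
    else - (row i centering) 0 a / n%:R.
  by rewrite -centering_axis row_mul axis_row.
by rewrite !e eqxx.
Qed.

(** The orthogonal projection on the vectors of zero sum that vanish at
    [a]. *)
Fact base_key : unit. Proof. by []. Qed.
Definition base a : 'M[R]_N := locked_with base_key (centering - axis a).

Lemma base_def a : base a = centering - axis a.
Proof. exact: (locked_withE base_key). Qed.

Lemma compressE a k : compress a k = base a + k *: axis a.
Proof. by rewrite compress_def base_def scalerBl scale1r opprB addrA addrAC.
  Qed.

Lemma base_tr a : (base a)^T = base a.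
Proof. by rewrite base_def linearB /= centering_tr axis_tr. Qed.

Lemma base_axis a : base a *m axis a = 0.
Proof. by rewrite base_def mulmxBl centering_axis axis_idem subrr. Qed.

Lemma axis_base a : axis a *m base a = 0.
Proof. by rewrite base_def mulmxBr axis_centering axis_idem subrr. Qed.

Lemma base_idem a : base a *m base a = base a.
Proof. by rewrite {1}base_def mulmxBl axis_base subr0 base_def mulmxBr
  centering_idem centering_axis. Qed.

Lemma compress1 a : compress a 1 = centering.
Proof. by rewrite compress_def subrr scale0r subr0. Qed.

Lemma compress0 a : compress a 0 = base a.
Proof. by rewrite compressE scale0r addr0. Qed.

Lemma base_entry (c : 'rV[R]_N) a : (c *m base a) 0 a = 0.
Proof.
have h : \sum_i (c *m centering) 0 i = 0 := centering_sum c.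
have -> : c *m base a = c *m centering - (c *m centering) *m axis a.
  by rewrite base_def mulmxBr -mulmxA centering_axis.
by rewrite mxE [X in _ + X]mxE axis_row // eqxx subrr.
Qed.

Lemma compress_tr a k : (compress a k)^T = compress a k.
Proof. by rewrite compressE linearD linearZ /= base_tr axis_tr. Qed.

Lemma compress_mul a k l : compress a k *m compress a l = compress a (k * l).
Proof.
rewrite !compressE mulmxDl !mulmxDr base_idem -!scalemxAl -!scalemxAr.
by rewrite base_axis axis_base axis_idem !scaler0 addr0 add0r scalerA.
Qed.

Lemma base_sympsd a : sympsd (base a).
Proof. exact: idem_sympsd (base_tr a) (base_idem a). Qed.

Lemma axis_sympsd a : sympsd (axis a).
Proof. exact: idem_sympsd (axis_tr a) (axis_idem a). Qed.

Lemma compress_sympsd a k : 0 <= k -> sympsd (compress a k).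
Proof.
move=> k0; split; first exact: compress_tr.
move=> w; rewrite compressE mulmxDr mulmxDl -scalemxAr -scalemxAl mxE [X in _ +
  X]mxE.
by rewrite addr_ge0 ?mulr_ge0 //; [apply: (proj2 (base_sympsd a)) | apply:
  (proj2 (axis_sympsd a))].
Qed.

Lemma compress_sum (c : 'rV[R]_N) a k : \sum_i (c *m compress a k) 0 i = 0.
Proof. by rewrite -[k]mulr1 -compress_mul mulmxA compress1 centering_sum. Qed.

(** In this section [D x] has the polar factor [Q], and [apexE] says that
    [D] collapses the axis of the apex as soon as [x] is degenerate. *)
Section Path.
Variables (x : 'M[R]_(N, n)) (a : 'I_N) (k : R) (Q : 'M[R]_(N, n)) (mu : R).
Hypotheses (gx : admissible x) (k01 : 0 <= k <= 1) (mu0 : 0 < mu).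
Hypothesis apexE :
  forall c b, dependency x c -> c != 0 -> apical c b -> k = 0 /\ b = a.
Hypothesis pol : polar (compress a k *m x) Q.
Local Notation D := (compress a k).
Local Notation T := (D *m x *m Q^T).

(** If [w] is killed by [T], then [w *m D] is a dependency of [x].  When
    [x] is degenerate, [D] is the projection [base a], so this dependency
    vanishes at [a] and hence everywhere. *)
Lemma polar_ker (w : 'rV[R]_N) : w *m T = 0 -> w *m D = 0.
Proof.
move=> wT; have dep : dependency x (w *m D).
  split; last exact: compress_sum.
  by rewrite -mulmxA -(polar_mulQ pol) mulmxA wT mul0mx.
have [//|c0] := eqVneq (w *m D) 0.
have [b hb] := gx dep c0; have [k0 ba] := apexE dep c0 hb.
by apply: (@admissible_zero_entry _ _ x _ a n0 gx dep);
  rewrite k0 compress0 base_entry.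
Qed.

(** [Q *m Q^T] is a projection fixing the image of [T], hence that of
    [D]. *)
Lemma compress_absorb : D *m (Q *m Q^T) = D.
Proof.
have [sT pT] := proj2 pol.
have PT : (1%:M - Q *m Q^T)^T = 1%:M - Q *m Q^T.
  by rewrite linearB /= tr_scalar_mx trmx_mul trmxK.
have z : (1%:M - Q *m Q^T) *m T = 0.
  apply: trmx_inj; rewrite trmx_mul sT PT mulmxBr mulmx1 (polar_absorb pol).
  by rewrite subrr trmx0.
have z' : (1%:M - Q *m Q^T) *m D = 0.
  apply/row_matrixP => i; rewrite row_mul row0; apply: polar_ker.
  by rewrite -row_mul z row0.
have : D *m (1%:M - Q *m Q^T) = 0.
  by apply: trmx_inj; rewrite trmx_mul PT compress_tr z' trmx0.
by rewrite mulmxBr mulmx1 => /eqP; rewrite subr_eq0 eq_sym => /eqP.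
Qed.

Lemma compress_gram : (mu *: (D *m Q)) *m (mu *: (D *m Q))^T = mu ^+ 2 *:
  compress a (k ^+ 2).
Proof.
rewrite linearZ /= -scalemxAl -scalemxAr scalerA -expr2 trmx_mul compress_tr.
by rewrite mulmxA -[D *m Q *m Q^T]mulmxA compress_absorb compress_mul -expr2.
Qed.

Variables al be ga : R.
Hypotheses (al0 : 0 <= al) (be0 : 0 <= be) (ga0 : 0 <= ga).
Hypotheses (sum1 : al + be + ga = 1) (alga : al * ga = 0).
Let M := mu *: (D *m Q).

Lemma apical_axis (c : 'rV[R]_N) : \sum_i c 0 i = 0 -> c != 0 ->
  c *m base a = 0 -> apical c a.
Proof.
move=> cs c0 cb; have cE : c = c *m axis a.
  by apply/eqP; rewrite -subr_eq0 -{1}(centering_fix cs) -mulmxBr -base_def cb.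
have ce i : c 0 i = if i == a then c 0 a else - c 0 a / n%:R.
  by rewrite {1}cE axis_row.
have ca : c 0 a != 0.
  apply: contraNneq c0 => ca; apply/eqP/rowP => i; rewrite ce ca mxE.
  by case: eqP; rewrite ?oppr0 ?mul0r.
move=> i ia; rewrite ce (negbTE ia) mulrAC mulNr -expr2 mulNr oppr_lt0.
by rewrite divr_gt0 ?ltr0n // lt_neqAle sqr_ge0 eq_sym sqrf_eq0 ca.
Qed.

(** When [k = 0] the target is degenerate with apex [a].  On the first
    segment a dependency [c] of the deformed configuration corresponds to the
    dependency [al *: c + be *: (c *m base a)] of [x], and moving back adds a
    multiple of the axis, which keeps the sign pattern by convexity.  On the
    second segment the dependencies are multiples of the axis. *)
Lemma path_admissible_flat : k = 0 ->
  admissible (al *: x + be *: (D *m x + (1%:M - D) *m M) + ga *: M).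
Proof.
move=> k0; rewrite /M k0 compress0 => c [cx cs] c0; exists a.
have kill : (1%:M - base a) *m (mu *: (base a *m Q)) = 0.
  by rewrite -scalemxAr mulmxA mulmxBl mul1mx base_idem subrr mul0mx scaler0.
rewrite kill addr0 in cx.
have [ga_0|ga_n0] := eqVneq ga 0.
  have albe : be = 1 - al by have := sum1; rewrite ga_0 => e; lra.
  pose c' := al *: c + be *: (c *m base a).
  have c'x : c' *m x = 0.
    rewrite -cx ga_0 scale0r addr0 mulmxDr -!scalemxAr /c' mulmxDl -!scalemxAl.
    by rewrite mulmxA.
  have cb i : (c *m base a) 0 i = if i == a then 0 else c 0 i + c 0 a / n%:R.
    rewrite base_def mulmxBr centering_fix // mxE [X in _ + X]mxE axis_row //.
    by case: eqP => [->|_]; rewrite ?subrr // mulNr opprK.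
  have c'i i : c' 0 i = if i == a then al * c 0 a else c 0 i + be * (c 0 a /
    n%:R).
    rewrite /c' mxE [X in X + _]mxE [X in _ + X]mxE cb; case: eqP => [->|_].
      by rewrite mulr0 addr0.
    by rewrite albe; ring.
  have [c'0|c'0] := eqVneq c' 0.
    have [al_0|al_n0] := eqVneq al 0.
      apply: apical_axis => //; move: c'0; rewrite /c' al_0 scale0r add0r.
      by rewrite albe al_0 subr0 scale1r.
    have ca : c 0 a = 0.
      apply/eqP; rewrite -(mulrI_eq0 _ (mulfI al_n0)).
      by have := c'i a; rewrite c'0 mxE eqxx => <-.
    case/eqP: c0; apply/rowP => i; have [->|ia] := eqVneq i a;
      first by rewrite ca mxE.
    have := c'i i; rewrite c'0 (negbTE ia) ca mul0r mulr0 addr0 mxE => e.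
    by rewrite -e ?mxE.
  have dep : dependency x c'.
    split=> //; under eq_bigr do rewrite mxE [X in X + _]mxE [X in _ + X]mxE.
    rewrite big_split /= -!mulr_sumr cs -compress0 compress_sum; ring.
  have [b hb] := gx dep c'0; have [_ ba] := apexE dep c'0 hb; subst b.
  move=> i ia; have := hb i ia; rewrite !c'i eqxx (negbTE ia) mulrCA => h.
  have h2 : (c 0 i + be * (c 0 a / n%:R)) * c 0 a < 0.
    by rewrite ltNge; apply: contraL h => h'; rewrite -leNgt mulr_ge0.
  apply: le_lt_trans h2; rewrite mulrDl lerDl.
  have -> : be * (c 0 a / n%:R) * c 0 a = be * (c 0 a ^+ 2 / n%:R) by ring.
  by rewrite mulr_ge0 // mulr_ge0 ?sqr_ge0 ?invr_ge0.
have al_0 : al = 0 by move/eqP: alga; rewrite mulf_eq0 (negbTE ga_n0) orbF =>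
  /eqP.
have [sT pT] := proj2 pol.
apply: apical_axis => //.
have TQ : base a *m x = T *m Q by rewrite -compress0 -k0 (polar_mulQ pol).
have bT : be *: (c *m T) + (ga * mu) *: (c *m base a) = 0.
  have : (be *: (c *m T) + (ga * mu) *: (c *m base a)) *m Q = 0.
    rewrite -[RHS]cx al_0 scale0r add0r mulmxDl -!scalemxAl mulmxDr -!scalemxAr.
    by rewrite TQ !mulmxA scalerA.
  move=> /(congr1 (mulmx^~ Q^T)); rewrite mul0mx -mulmxA mulmxDl -!scalemxAl.
  rewrite -[c *m T *m _]mulmxA (polar_absorb pol) -[c *m base a *m _]mulmxA.
  by rewrite -compress0 -k0 compress_absorb.
have := congr1 (fun A : 'rV[R]_N => (A *m c^T) 0 0) bT.
rewrite mul0mx mulmxDl -!scalemxAl [LHS]mxE [X in X + _]mxE [X in _ + X]mxE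
  [RHS]mxE.
have q1 := pT c; have q2 := proj2 (base_sympsd a) c => e.
have [be_0|be_n0] := eqVneq be 0.
  apply: psd_form0; first exact: base_sympsd.
  move: e; rewrite be_0 mul0r add0r => /eqP; rewrite mulf_eq0 => /orP[|/eqP//].
  by rewrite mulf_eq0 (negbTE ga_n0) gt_eqF.
rewrite -compress0 -k0; apply: polar_ker; apply: psd_form0 => //.
have s1 : 0 <= be * (c *m T *m c^T) 0 0 by rewrite mulr_ge0.
have s2 : 0 <= ga * mu * (c *m base a *m c^T) 0 0 by rewrite !mulr_ge0 // ltW.
have : be * (c *m T *m c^T) 0 0 = 0 by lra.
by move=> /eqP; rewrite mulf_eq0 (negbTE be_n0) => /eqP.
Qed.

(** When [k != 0] the whole path is nondegenerate.  Pairing a dependency [c]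
    with [q], the vector for which [c *m (al *: x + be *: (D *m x)) =
    q *m T *m Q], expresses zero as a sum of positive semidefinite forms, and
    the vanishing of each of them forces [c = 0]. *)
Lemma path_admissible_solid : k != 0 ->
  admissible (al *: x + be *: (D *m x + (1%:M - D) *m M) + ga *: M).
Proof.
move=> k_n0 c [cx cs] c0; exfalso; move/eqP: c0; apply.
have [k0 k1] := andP k01; have kp : 0 < k by rewrite lt_neqAle eq_sym k_n0.
have [sT pT] := proj2 pol.
have cC := centering_fix cs.
have DD' : compress a k^-1 *m D = centering by rewrite compress_mul mulVf //
  compress1.
have D'D : D *m compress a k^-1 = centering by rewrite compress_mul mulfV //
  compress1.
have cD0 : c *m D = 0 -> c = 0 by move=> cD; rewrite -cC -D'D mulmxA cD mul0mx.
(* On the vectors of zero sum [compress a k^-1] inverts [D], so that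
   [x = compress a k^-1 *m T *m Q] up to a translation. *)
pose q := al *: (c *m compress a k^-1) + be *: c.
pose r := (be * (k * (1 - k))) *: (c *m axis a) + ga *: (c *m D).
have qDE : q *m D = al *: c + be *: (c *m D).
  by rewrite /q mulmxDl -!scalemxAl -[c *m _ *m D]mulmxA DD' cC.
have v0 : q *m T + mu *: r = 0.
  have e1 : (q *m T + mu *: r) *m Q = 0.
    have cM : c *m ((1%:M - D) *m M) = (mu * (k * (1 - k))) *: (c *m axis a *m
      Q).
      rewrite /M -scalemxAr -scalemxAr mulmxA mulmxA.
      have -> : c *m (1%:M - D) *m D = (k * (1 - k)) *: (c *m axis a).
        have eJ : centering - D = (1 - k) *: axis a by rewrite compress_def
          opprB addrC subrK.
        rewrite mulmxBr mulmx1 -{1}cC -mulmxBr eJ -scalemxAr -scalemxAl -mulmxA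
          compressE.
        by rewrite mulmxDr axis_base add0r -scalemxAr axis_idem -scalemxAr
          scalerA mulrC.
      by rewrite -scalemxAl scalerA.
    have lin (A B C : 'M[R]_(N, n)) : c *m (al *: A + be *: B + ga *: C) =
        al *: (c *m A) + be *: (c *m B) + ga *: (c *m C).
      by rewrite !mulmxDr -!scalemxAr.
    have cM' : c *m M = mu *: (c *m D *m Q) by rewrite /M -scalemxAr mulmxA.
    rewrite -[RHS]cx lin mulmxDr cM cM' mulmxDl -[q *m T *m Q]mulmxA.
    rewrite (polar_mulQ pol) !mulmxA qDE mulmxDl -!scalemxAl.
    rewrite /r mulmxDl -!scalemxAl !scalerDr !scalerA -!addrA.
    by congr (_ + (_ + (_ *: _ + _ *: _))); ring.
  have qP : q *m T *m (Q *m Q^T) = q *m T by rewrite -[LHS]mulmxA (polar_absorb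
    pol).
  have rP : r *m (Q *m Q^T) = r.
    rewrite /r mulmxDl -!scalemxAl -[c *m D *m (Q *m Q^T)]mulmxA
      compress_absorb.
    suff -> : c *m axis a *m (Q *m Q^T) = c *m axis a by [].
    have -> : c *m axis a = k^-1 *: (c *m axis a *m D).
      rewrite -mulmxA compressE mulmxDr axis_base add0r -scalemxAr axis_idem.
      by rewrite -scalemxAr scalerA mulVf // scale1r.
    by rewrite -scalemxAl -[_ *m D *m _]mulmxA compress_absorb.
  by rewrite -qP -rP scalemxAl -mulmxDl mulmxA e1 mul0mx.
have q0 : q *m T = 0.
  apply: psd_form0 => //.
  have := congr1 (fun A : 'rV[R]_N => (A *m q^T) 0 0) v0.
  rewrite mul0mx mulmxDl -scalemxAl [LHS]mxE [X in _ + X]mxE [RHS]mxE.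
  have -> : (r *m q^T) 0 0 =
      be * (k * (1 - k)) * (al / k + be) * (c *m axis a *m c^T) 0 0
      + ga * be * (c *m D *m c^T) 0 0.
    have qT : q^T = al *: (compress a k^-1 *m c^T) + be *: c^T.
      by rewrite /q linearD !linearZ /= trmx_mul compress_tr.
    have cE : c *m axis a *m q^T = (al / k + be) *: (c *m axis a *m c^T).
      have aD : c *m axis a *m compress a k^-1 = k^-1 *: (c *m axis a).
        by rewrite -mulmxA compressE mulmxDr axis_base add0r -scalemxAr
          axis_idem -scalemxAr.
      rewrite qT mulmxDr -!scalemxAr [_ *m (_ *m c^T)]mulmxA aD -scalemxAl.
      by rewrite scalerA -scalerDl.
    have cD : c *m D *m q^T = al *: (c *m c^T) + be *: (c *m D *m c^T).
      by rewrite qT mulmxDr -!scalemxAr [_ *m (_ *m c^T)]mulmxA -[c *m D *m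
        compress _ _]mulmxA D'D cC.
    rewrite /r mulmxDl -!scalemxAl cE cD scalerDr !scalerA [ga * al]mulrC alga
      scale0r.
    by rewrite add0r [LHS]mxE [X in X + _]mxE [X in _ + X]mxE.
  have p1 := pT q; have p2 := proj2 (axis_sympsd a) c.
  have p3 := proj2 (compress_sympsd a k0) c => e.
  have k1' : 0 <= 1 - k by rewrite subr_ge0.
  have s1 : 0 <= be * (k * (1 - k)) * (al / k + be) * (c *m axis a *m c^T) 0 0.
    rewrite mulr_ge0 // mulr_ge0 //; first by rewrite mulr_ge0 // mulr_ge0.
    by rewrite addr_ge0 // divr_ge0.
  have s2 : 0 <= ga * be * (c *m D *m c^T) 0 0 by rewrite !mulr_ge0.
  have s3 := mulr_ge0 (ltW mu0) (addr_ge0 s1 s2).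
  lra.
have qD : al *: c + be *: (c *m D) = 0 by rewrite -qDE (polar_ker q0).
have [al_0|al_n0] := eqVneq al 0.
  have [be_0|be_n0] := eqVneq be 0.
    have ga1 : ga = 1 by have := sum1; rewrite al_0 be_0 !add0r.
    apply: cD0; move/eqP: v0; rewrite q0 add0r /r be_0 mul0r scale0r add0r ga1.
    by rewrite scale1r scaler_eq0 gt_eqF // => /eqP.
  apply: cD0; move/eqP: qD; rewrite al_0 scale0r add0r scaler_eq0 (negbTE
    be_n0).
  by move=> /eqP.
have := congr1 (fun A : 'rV[R]_N => (A *m c^T) 0 0) qD.
rewrite mul0mx mulmxDl -!scalemxAl [LHS]mxE [X in X + _]mxE [X in _ + X]mxE
  [RHS]mxE.
have p3 := mulr_ge0 be0 (proj2 (compress_sympsd a k0) c).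
have p4 := mulr_ge0 al0 (sqnorm_ge0 c) => e.
have : al * (c *m c^T) 0 0 = 0 by lra.
move=> /eqP; rewrite mulf_eq0 (negbTE al_n0) /= => /eqP.
exact: sqnorm_eq0.
Qed.

Lemma path_admissible : admissible (al *: x + be *: (D *m x + (1%:M - D) *m M)
  + ga *: M).
Proof.
by have [k0|k0] := eqVneq k 0; [exact: path_admissible_flat | exact:
  path_admissible_solid].
Qed.

End Path.
End Compress.

(** * Areas of the facets *)

Section EuclideanNorm.
Context {R : rcfType}.

Definition enorm n (u : 'rV[R]_n) : R := Num.sqrt ((u *m u^T) 0 0).

Lemma sqr_enorm n (u : 'rV[R]_n) : enorm u ^+ 2 = (u *m u^T) 0 0.
Proof. by rewrite sqr_sqrtr // sqnorm_ge0. Qed.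

Lemma enormZ n (t : R) (u : 'rV[R]_n) : enorm (t *: u) = `|t| * enorm u.
Proof.
rewrite /enorm linearZ /= -scalemxAl -scalemxAr scalerA mxE -expr2.
by rewrite sqrtrM ?sqr_ge0 // sqrtr_sqr.
Qed.

Lemma enormD n (u v : 'rV[R]_n) : enorm (u + v) <= enorm u + enorm v.
Proof.
have s1 : sympsd (1%:M : 'M[R]_n) := sympsd1 n.
rewrite -(ler_pXn2r (ltn0Sn 1)) ?nnegrE ?addr_ge0 ?sqrtr_ge0 //.
have := form_addZ u v 1 (proj1 s1); rewrite !mulmx1 scale1r => e.
rewrite sqr_enorm e sqrrD !sqr_enorm expr1n mulr1 mul1r lerD2r lerD2l.
rewrite -[X in _ <= X]mulr_natl ler_pM2l ?ltr0n //.
have := psd_CS u v s1; rewrite !mulmx1 -!sqr_enorm -exprMn => cs.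
apply: le_trans (ler_norm _) _; rewrite -ler_sqr ?nnegrE ?mulr_ge0 ?sqrtr_ge0
  //.
by rewrite real_normK ?num_real.
Qed.

Lemma enorm_sum n (I : finType) (P : pred I) (f : I -> 'rV[R]_n) :
  enorm (\sum_(i | P i) f i) <= \sum_(i | P i) enorm (f i).
Proof.
elim/big_ind2 : _ => [|u r v s ur vs|//].
  by rewrite /enorm mul0mx mxE sqrtr0.
by apply: le_trans (enormD _ _) _; rewrite lerD.
Qed.

End EuclideanNorm.

Section FacetNormals.
Context {R : realType} {n : nat}.
Local Notation N := n.+1.
Implicit Types (x : 'M[R]_(N, n)) (a i j : 'I_N).

(** The vertices in homogeneous coordinates, the column 0 being constant. *)
Definition aug x : 'M[R]_N :=
  \matrix_(i, l) if unlift ord0 l is Some k then x i k else 1.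

(** Up to a common factor, the row [i] is the normal of the facet opposite
    to [i] weighted by the area of that facet. *)
Definition facet_normals x : 'M[R]_(N, n) :=
  \matrix_(i, k) cofactor (aug x) i (lift ord0 k).

Definition area x i : R := enorm (row i (facet_normals x)).

Lemma aug0 x i : aug x i ord0 = 1.
Proof. by rewrite mxE unlift_none. Qed.

Lemma aug_lift x i k : aug x i (lift ord0 k) = x i k.
Proof. by rewrite mxE liftK. Qed.

(** The relation of Minkowski. *)
Lemma facet_normals_sum x k : \sum_i facet_normals x i k = 0.
Proof.
have := congr1 (fun A : 'M[R]_N => A (lift ord0 k) ord0) (mul_adj_mx (aug x)).
rewrite mxE [RHS]mxE eq_sym eq_liftF mulr0n => e0; rewrite -[RHS]e0.
by apply: eq_bigr => i _; rewrite aug0 mulr1 !mxE.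
Qed.

Lemma facet_normals_tr_mul x : (facet_normals x)^T *m x = (\det (aug x))%:M.
Proof.
apply/matrixP => k l.
have := congr1 (fun A : 'M[R]_N => A (lift ord0 k) (lift ord0 l)) (mul_adj_mx
  (aug x)).
rewrite mxE [RHS]mxE (inj_eq lift_inj) => e.
by rewrite [RHS]mxE -e mxE; apply: eq_bigr => i _; rewrite aug_lift !mxE.
Qed.

Lemma mul_facet_normals x : exists u : 'rV[R]_N,
  x *m (facet_normals x)^T = (\det (aug x))%:M - const_mx 1 *m u.
Proof.
exists (\row_i cofactor (aug x) i ord0); apply/matrixP => j i.
have := congr1 (fun A : 'M[R]_N => A j i) (mul_mx_adj (aug x)).
rewrite mxE big_ord_recl aug0 mul1r [RHS]mxE => e.
have cu (u : 'rV[R]_N) : ((const_mx 1 : 'cV[R]_N) *m u) j i = u 0 i.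
  by rewrite mxE big_ord1 mxE mul1r.
rewrite [RHS]mxE [X in _ = X + _]mxE -e [X in _ = _ + X]mxE cu !mxE addrC addKr.
by apply: eq_bigr => k _; rewrite aug_lift !mxE.
Qed.

Definition replace_row (A : 'M[R]_N) i (y : 'rV[R]_N) : 'M[R]_N :=
  \matrix_(j, l) if j == i then y 0 l else A j l.

Lemma det_replace_row (A : 'M[R]_N) i (y : 'rV[R]_N) :
  \det (replace_row A i y) = \sum_l y 0 l * cofactor A i l.
Proof.
rewrite (expand_det_row _ i); apply: eq_bigr => l _; rewrite mxE eqxx.
congr (_ * (_ * \det _)); apply/matrixP => j k.
by rewrite !mxE eq_sym (negbTE (neq_lift _ _)).
Qed.

(** The vertices other than [i] lie on a hyperplane.  Pairing its normal
    with the row [i] gives the determinant of [aug x] with this normal, as a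
    point at infinity, in place of the vertex [i]; it vanishes only if the
    other vertices are affinely dependent. *)
Lemma facet_normal_n0 x i : (0 < n)%N -> admissible x ->
  row i (facet_normals x) != 0.
Proof.
move=> n0 gx; apply/negP => /eqP w0.
have wk k : cofactor (aug x) i (lift ord0 k) = 0.
  by have /rowP/(_ k) := w0; rewrite !mxE.
pose B := replace_row (aug x) i 0.
have dB : \det B^T == 0.
  rewrite det_tr /B det_replace_row big1 // => l _.
  by rewrite mxE mul0r.
have [v v0 vB] := det0P dB.
have Bj j : j != i -> v 0 ord0 + \sum_k x j k * v 0 (lift ord0 k) = 0.
  move=> ji; have /rowP/(_ j) := vB; rewrite mxE [RHS]mxE => e0;
    rewrite -[RHS]e0.
  rewrite big_ord_recl; congr (_ + _).
    by rewrite !mxE (negbTE ji) unlift_none mulr1.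
  by apply: eq_bigr => k _; rewrite !mxE (negbTE ji) liftK mulrC.
(* [v] is the affine form that vanishes at the other vertices, and [y] its
   linear part. *)
pose y : 'rV[R]_N := \row_l if unlift ord0 l is Some k then v 0 l else 0.
have dC : \det (replace_row (aug x) i y) == 0.
  rewrite det_replace_row big_ord_recl mxE unlift_none mul0r add0r big1 // => k
    _.
  by rewrite wk mulr0.
have [d d0 dC0] := det0P dC.
have col0 : \sum_(j | j != i) d 0 j = 0.
  have /rowP/(_ ord0) := dC0; rewrite mxE [RHS]mxE (bigD1 i) //= !mxE eqxx.
  rewrite unlift_none mulr0 add0r => e0; rewrite -[RHS]e0;
    apply: eq_bigr => j ji.
  by rewrite !mxE (negbTE ji) unlift_none mulr1.
have colk k : d 0 i * v 0 (lift ord0 k) + \sum_(j | j != i) d 0 j * x j k = 0.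
  have /rowP/(_ (lift ord0 k)) := dC0; rewrite mxE [RHS]mxE (bigD1 i) //= !mxE
    eqxx.
  rewrite liftK => e0; rewrite -[RHS]e0; congr (_ + _); apply: eq_bigr => j ji.
  by rewrite !mxE (negbTE ji) liftK.
have dvv : d 0 i * (\sum_k v 0 (lift ord0 k) ^+ 2) = 0.
  have : \sum_k v 0 (lift ord0 k) * (d 0 i * v 0 (lift ord0 k)
      + \sum_(j | j != i) d 0 j * x j k) = 0.
    by rewrite big1 // => k _; rewrite colk mulr0.
  under eq_bigr do rewrite mulrDr mulr_sumr.
  rewrite big_split /= exchange_big /=.
  have -> : \sum_(j | j != i) \sum_k v 0 (lift ord0 k) * (d 0 j * x j k) =
      - v 0 ord0 * \sum_(j | j != i) d 0 j.
    rewrite mulr_sumr; apply: eq_bigr => j ji; have := Bj j ji.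
    rewrite addrC => /eqP; rewrite addr_eq0 => /eqP <-; rewrite mulr_suml.
    by apply: eq_bigr => k _; ring.
  rewrite col0 mulr0 addr0 mulr_sumr => e0; rewrite -[RHS]e0.
  by apply: eq_bigr => k _; ring.
move/eqP: dvv; rewrite mulf_eq0 => /orP[/eqP di|].
  suff : d = 0 by move/eqP; exact/negP.
  apply: (admissible_zero_entry n0 gx _ di); split; last first.
    by rewrite (bigD1 i) //= di add0r.
  apply/rowP => k; rewrite mxE (bigD1 i) //= di mul0r add0r [RHS]mxE.
  by have := colk k; rewrite di mul0r add0r.
rewrite psumr_eq0 => [/allP h|k _]; last exact: sqr_ge0.
have vk k : v 0 (lift ord0 k) = 0.
  by apply/eqP; rewrite -sqrf_eq0; apply: h; rewrite mem_index_enum.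
have [j ji] := other_vertex i n0.
have v00 : v 0 ord0 = 0.
  by have := Bj j ji; rewrite big1 ?addr0 // => k _; rewrite vk mulr0.
case/eqP: v0; apply/rowP => l; rewrite [RHS]mxE.
by case: (unliftP ord0 l) => [k|] ->.
Qed.

Lemma area_gt0 x i : (0 < n)%N -> admissible x -> 0 < area x i.
Proof.
move=> n0 gx; rewrite /area /enorm sqrtr_gt0 lt_neqAle sqnorm_ge0 andbT eq_sym.
apply: contraNneq (facet_normal_n0 i n0 gx) => w0; apply/eqP.
exact: sqnorm_eq0.
Qed.

Lemma area_triangle x a : area x a <= \sum_(b | b != a) area x b.
Proof.
have e : row a (facet_normals x) = (-1) *: \sum_(b | b != a) row b
  (facet_normals x).
  rewrite scaleN1r; apply/eqP; rewrite -addr_eq0; apply/eqP/rowP => k.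
  rewrite mxE summxE [RHS]mxE -[RHS](facet_normals_sum x k) [in RHS](bigD1 a)
    //=.
  by rewrite mxE; congr (_ + _); apply: eq_bigr => b _; rewrite mxE.
by rewrite {1}/area e enormZ normrN1 mul1r enorm_sum.
Qed.

(** For degenerate [x] each coordinate of the normals is a dependency, so
    the areas are proportional to the absolute values of the entries
    of [c]. *)
Lemma area_flat x c a : (0 < n)%N -> admissible x -> dependency x c -> c != 0 ->
  apical c a -> area x a = \sum_(b | b != a) area x b.
Proof.
move=> n0 gx dc c0 ac.
have det0 : \det (aug x) = 0.
  apply/eqP/det0P; exists c => //; have [cx cs] := dc.
  apply/rowP => l; rewrite mxE [RHS]mxE; case: (unliftP ord0 l) => [k|] ->.
    have /rowP/(_ k) := cx; rewrite mxE [RHS]mxE => e0; rewrite -[RHS]e0.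
    by apply: eq_bigr => i _; rewrite aug_lift.
  by rewrite -[RHS]cs; apply: eq_bigr => i _; rewrite aug0 mulr1.
have ca : c 0 a != 0.
  by apply: contraNneq c0 => ca; apply/eqP; exact: admissible_zero_entry dc ca.
have prop b : c 0 a *: row b (facet_normals x) = c 0 b *: row a (facet_normals
  x).
  apply/rowP => k; rewrite !mxE.
  pose w : 'rV[R]_N := \row_i facet_normals x i k.
  have dw : dependency x w.
    split; last by under eq_bigr do rewrite mxE; exact: facet_normals_sum.
    apply/rowP => l; have := congr1 (fun A : 'M[R]_n => A k l)
      (facet_normals_tr_mul x).
    rewrite det0 mxE => e; rewrite mxE [RHS]mxE; transitivity ((0%:M : 'M[R]_n)
      k l).
      by rewrite -e; apply: eq_bigr => i _; rewrite !mxE.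
    by rewrite !mxE mul0rn.
  have : c 0 a *: w - w 0 a *: c = 0.
    apply: (@admissible_zero_entry _ _ x _ a n0 gx); last by rewrite !mxE; ring.
    have [[cx cs] [wx ws]] := (dc, dw); split.
      by rewrite mulmxBl -!scalemxAl cx wx !scaler0 subrr.
    under eq_bigr do rewrite mxE [X in X + _]mxE [X in _ + X]mxE [X in - X]mxE.
    by rewrite sumrB -!mulr_sumr cs ws !mulr0 subrr.
  move=> /rowP/(_ b); rewrite !mxE => /eqP; rewrite subr_eq0 => /eqP ->.
  by rewrite mulrC.
have ab b : `|c 0 a| * area x b = `|c 0 b| * area x a.
  by rewrite -!enormZ prop.
apply: (mulfI (_ : `|c 0 a| != 0)); first by rewrite normr_eq0.
rewrite mulr_sumr; under eq_bigr do rewrite ab.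
rewrite -mulr_suml; congr (_ * _).
have cs : c 0 a = - \sum_(b | b != a) c 0 b.
  by apply/eqP; rewrite -addr_eq0 -[X in _ == X](proj2 dc) [X in _ == X](bigD1
    a).
have [neg|pos] := ltP (c 0 a) 0.
  rewrite ltr0_norm // {1}cs opprK; apply: eq_bigr => b /ac.
  by rewrite nmulr_llt0 // => /gtr0_norm ->.
have pos' : 0 < c 0 a by rewrite lt_neqAle eq_sym ca.
rewrite gtr0_norm // {1}cs -sumrN; apply: eq_bigr => b /ac.
by rewrite pmulr_llt0 // => /ltr0_norm ->.
Qed.

Lemma area_row_perm x (s : 'S_N) i : area (row_perm s x) i = area x (s i).
Proof.
have aug_s : aug (row_perm s x) = row_perm s (aug x).
  by apply/matrixP => p q; rewrite !mxE; case: unlift => // k; rewrite mxE.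
have cof (A : 'M[R]_N) p q : cofactor A p q = \det (replace_row A p (delta_mx 0
  q)).
  rewrite det_replace_row (bigD1 q) //= mxE !eqxx mul1r big1 ?addr0 // => l
    /negbTE lq.
  by rewrite mxE lq andbF mul0r.
have e k : facet_normals (row_perm s x) i k = (-1) ^+ s * facet_normals x (s i)
  k.
  rewrite mxE [in RHS]mxE aug_s !cof.
  have -> : replace_row (row_perm s (aug x)) i (delta_mx 0 (lift ord0 k)) =
     row_perm s (replace_row (aug x) (s i) (delta_mx 0 (lift ord0 k))).
    by apply/matrixP => p q; rewrite !mxE (inj_eq perm_inj).
  by rewrite row_permE det_mulmx det_perm.
rewrite /area; have -> : row i (facet_normals (row_perm s x)) =
    (-1) ^+ s *: row (s i) (facet_normals x).
  by apply/rowP => k; rewrite mxE e [RHS]mxE [X in _ = _ * X]mxE.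
by rewrite enormZ normrX normrN1 expr1n mul1r.
Qed.

End FacetNormals.

(** * The deformation of labelled configurations *)

Section Flatness.
Context {R : realType} {n : nat}.
Hypothesis n2 : (2 <= n)%N.
Local Notation N := n.+1.
Implicit Types (x : 'M[R]_(N, n)) (a b i j : 'I_N).

Let n0 : (0 < n)%N. Proof. exact: ltnW. Qed.

(** Nonnegative by the triangle inequality, and zero when [x] is degenerate
    with apex [a]. *)
Definition excess x a : R := (\sum_(b | b != a) area x b) ^+ 2 - area x a ^+ 2.

(** Positive exactly when the facet opposite to [a] is strictly larger than
    all the others.  The default value of the minimum is never smaller than
    its entries. *)
Definition gap x a : R :=
  \big[Num.min/area x a ^+ 2]_(b | b != a) Num.max 0 (area x a ^+ 2 - area x b
    ^+ 2).

(** The weight of [gap] is fixed by the pyramids: with areas A of the base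
    and B of the other facets, the denominator is (n^2 - 1) A^2, and the
    quotient is the square of the ratio of the height to the regular one. *)
Definition height_ratio x a : R :=
  Num.sqrt (excess x a / (excess x a + n%:R ^+ 2 * gap x a)).

Lemma area_ge0 x a : 0 <= area x a.
Proof. exact: sqrtr_ge0. Qed.

Lemma excess_ge0 x a : 0 <= excess x a.
Proof.
rewrite subr_ge0 ler_sqr ?nnegrE ?area_ge0 ?area_triangle //.
by apply: sumr_ge0 => b _; exact: area_ge0.
Qed.

Lemma gap_ge0 x a : 0 <= gap x a.
Proof. by apply/bigmin_geP; split=> [|b _]; rewrite ?sqr_ge0 // le_max lexx.
  Qed.

Lemma gap_gt0 x a b : 0 < gap x a -> b != a -> area x b < area x a.
Proof.
move=> /bigmin_gtP[_ /(_ b)] h ba; have := h ba.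
by rewrite lt_max ltxx /= subr_gt0 ltr_sqr ?nnegrE ?area_ge0.
Qed.

(** If the area opposite to [a] is the sum of the other areas, which are
    positive and at least two in number, then it exceeds each of them. *)
Lemma denom_gt0 x a : admissible x -> 0 < excess x a + n%:R ^+ 2 * gap x a.
Proof.
move=> gx; have e0 := excess_ge0 x a; have g0 := gap_ge0 x a.
have nn : 0 < n%:R ^+ 2 :> R by rewrite exprn_gt0 // ltr0n.
have [ep|e_le0] := ltP 0 (excess x a).
  by rewrite ltr_pwDl // mulr_ge0 // ltW.
have eq0 : excess x a = 0 by apply/eqP; rewrite eq_le e_le0.
rewrite eq0 add0r mulr_gt0 //; apply/bigmin_gtP; split=> [|b ba].
  by rewrite exprn_gt0 // area_gt0.
rewrite lt_max; apply/orP; right; rewrite subr_gt0 ltr_sqr ?nnegrE ?area_ge0 //.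
have -> : area x a = \sum_(c | c != a) area x c.
  apply/eqP; rewrite -(@eqrXn2 _ 2) ?area_ge0 //; last first.
    by apply: sumr_ge0 => c _; exact: area_ge0.
  by rewrite eq_sym -subr_eq0 -/(excess x a) eq0.
rewrite (bigD1 b) //= ltrDl.
have [c /andP[ca cb]] : exists c, (c != a) && (c != b).
  apply/existsP; apply: contraT; rewrite negb_exists => /forallP h.
  have : (#|[set: 'I_N]%SET| <= #|[set a; b]%SET|)%N.
    apply: subset_leq_card; apply/fintype.subsetP => c _; rewrite !inE.
    by have := h c; rewrite negb_and !negbK.
  by rewrite cardsT card_ord cards2 eq_sym ba ltnNge n2.
rewrite (bigD1 c) ?ca ?cb //= ltr_pwDl ?area_gt0 //.
by apply: sumr_ge0 => d _; exact: area_ge0.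
Qed.

Lemma height_ratio_ge0 x a : 0 <= height_ratio x a.
Proof. exact: sqrtr_ge0. Qed.

Lemma height_ratio_le1 x a : admissible x -> height_ratio x a <= 1.
Proof.
move=> gx; rewrite -sqrtr1 ler_wsqrtr // ler_pdivrMr ?denom_gt0 // mul1r lerDl.
by rewrite mulr_ge0 ?gap_ge0 // exprn_ge0.
Qed.

Lemma height_ratio_eq1 x a : admissible x -> gap x a = 0 ->
  height_ratio x a = 1.
Proof.
move=> gx g0; have := denom_gt0 a gx; rewrite /height_ratio g0 mulr0 addr0 =>
  e0.
by rewrite divff ?sqrtr1 // gt_eqF.
Qed.

Lemma height_ratio_lt1_unique x a b : admissible x -> height_ratio x a != 1 ->
  b != a ->
  height_ratio x b = 1.
Proof.
move=> gx fa ba; apply: height_ratio_eq1 => //; apply/eqP; apply: contraT => gb.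
have ga : 0 < gap x a.
  by rewrite lt_neqAle gap_ge0 andbT eq_sym; apply: contra fa => /eqP
    /(height_ratio_eq1 gx) ->.
have gb' : 0 < gap x b by rewrite lt_neqAle gap_ge0 andbT eq_sym.
have := lt_trans (gap_gt0 ga ba) (gap_gt0 gb' (_ : a != b)).
by rewrite ltxx => ->//; rewrite eq_sym.
Qed.

Lemma height_ratio_flat x c a : admissible x -> dependency x c -> c != 0 ->
  apical c a -> height_ratio x a = 0.
Proof.
move=> gx dc c0 ac; rewrite /height_ratio /excess (area_flat n0 gx dc c0 ac).
by rewrite subrr mul0r sqrtr0.
Qed.

Lemma height_ratio_row_perm x (s : 'S_N) a :
  height_ratio (row_perm s x) a = height_ratio x (s a).
Proof.
have e : excess (row_perm s x) a = excess x (s a).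
  rewrite /excess area_row_perm; congr (_ ^+ 2 - _).
  rewrite [RHS](reindex_inj (@perm_inj _ s)) /=.
  by apply: eq_big => b; rewrite ?(inj_eq perm_inj) // area_row_perm.
have g : gap (row_perm s x) a = gap x (s a).
  rewrite /gap area_row_perm [RHS](reindex_inj (@perm_inj _ s)) /=.
  by apply: eq_big => b; rewrite ?(inj_eq perm_inj) // area_row_perm.
by rewrite /height_ratio e g.
Qed.

(** Summing over all vertices instead of choosing the apex keeps the
    definition continuous and symmetric; on admissible configurations at most
    one term is nonzero. *)
Fact flattener_key : unit. Proof. by []. Qed.
Definition flattener x : 'M[R]_N :=
  locked_with flattener_key (centering - \sum_a (1 - height_ratio x a) *: axis
    a).

Lemma flattener_def x :
  flattener x = centering - \sum_a (1 - height_ratio x a) *: axis a.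
Proof. exact: (locked_withE flattener_key). Qed.

Lemma flattenerE x i j :
  flattener x i j = centering i j - \sum_a (1 - height_ratio x a) * axis a i j.
Proof.
rewrite flattener_def mxE [X in _ + X]mxE summxE; congr (_ - _).
by apply: eq_bigr => a _; rewrite mxE.
Qed.

Lemma flattener_compress x : admissible x -> exists2 a,
  flattener x = compress a (height_ratio x a) & forall b, b != a ->
    height_ratio x b = 1.
Proof.
move=> gx; pose P := [exists a, height_ratio x a != 1].
have [a ha] : exists a, forall b, b != a -> height_ratio x b = 1.
  have [/existsP[a fa]|] := boolP P.
    by exists a => b; exact: height_ratio_lt1_unique.
  rewrite negb_exists => /forallP h; exists ord0 => b _.
  by apply/eqP; have := h b; rewrite negbK.
exists a => //; rewrite flattener_def compress_def (bigD1 a) //= big1 ?addr0 //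
  => b ba.
by rewrite ha // subrr scale0r.
Qed.

Lemma flattener_apex x a : admissible x -> (forall b, b != a ->
  height_ratio x b = 1) ->
  forall c b, dependency x c -> c != 0 -> apical c b ->
  height_ratio x a = 0 /\ b = a.
Proof.
move=> gx ha c b dc c0 ab; have fb := height_ratio_flat gx dc c0 ab.
have [ba|/ha] := eqVneq b a; first by rewrite -ba.
by rewrite fb => /eqP; rewrite eq_sym oner_eq0.
Qed.

Lemma flattener_tr x : (flattener x)^T = flattener x.
Proof.
rewrite flattener_def linearB /= centering_tr linear_sum /=; congr (_ - _).
by apply: eq_bigr => a _; rewrite linearZ /= axis_tr.
Qed.

Lemma row_perm_dependency x (s : 'S_N) (c : 'rV[R]_N) :
  dependency (row_perm s x) c -> dependency x (c *m perm_mx s).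
Proof.
move=> [cx cs]; split; first by rewrite -mulmxA -row_permE.
rewrite -[RHS]cs (reindex_inj (@perm_inj _ s)) /=; apply: eq_bigr => i _.
by rewrite -[s in perm_mx s]invgK -col_permE mxE permK.
Qed.

Lemma admissible_row_perm x (s : 'S_N) : admissible x ->
  admissible (row_perm s x).
Proof.
move=> gx c dc c0; have ce i : (c *m perm_mx s) 0 (s i) = c 0 i.
  by rewrite -[s in perm_mx s]invgK -col_permE mxE permK.
have [|b hb] := gx _ (row_perm_dependency dc).
  apply: contraNneq c0 => e; apply/eqP/rowP => i.
  by rewrite -ce e !mxE.
exists (s^-1 b)%g => i ib; rewrite -!ce permKV; apply: hb.
by apply: contraNneq ib => <-; rewrite permK.
Qed.

Lemma flattener_row_perm x (s : 'S_N) :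
  flattener (row_perm s x) = perm_mx s *m flattener x *m (perm_mx s)^T.
Proof.
apply/matrixP => i j.
have -> : (perm_mx s *m flattener x *m (perm_mx s)^T) i j = flattener x (s i)
  (s j).
  by rewrite tr_perm_mx -col_permE -row_permE !mxE.
rewrite [LHS]flattenerE [RHS]flattenerE (centeringE i j) (centeringE (s i)).
rewrite (inj_eq perm_inj); congr (_ - _).
rewrite [RHS](reindex_inj (@perm_inj _ s)) /=; apply: eq_bigr => a _.
by rewrite height_ratio_row_perm !axisE !centeringE !(inj_eq perm_inj).
Qed.

End Flatness.

Section Model.
Context {R : realType} {n : nat}.
Hypothesis n2 : (2 <= n)%N.
Local Notation N := n.+1.
Implicit Types (x : 'M[R]_(N, n)) (a b i j : 'I_N).

Let n0 : (0 < n)%N. Proof. exact: ltnW. Qed.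

(** The points of a configuration with Gram matrix [centering] are at mutual
    distance the square root of 2. *)
Definition edge_scale : R := (Num.sqrt 2)^-1.

Lemma edge_scale_gt0 : 0 < edge_scale.
Proof. by rewrite invr_gt0 sqrtr_gt0 ltr0n. Qed.

Lemma edge_scale_sqr : edge_scale ^+ 2 = 2^-1.
Proof. by rewrite exprVn sqr_sqrtr // ler0n. Qed.

Definition polar_factor (Y : 'M[R]_(N, n)) : 'M[R]_(N, n) :=
  sval (cid (polar_exists Y (leqnSn n))).

Lemma polar_factorP Y : polar Y (polar_factor Y).
Proof. exact: svalP (cid _). Qed.

Definition model x : 'M[R]_(N, n) :=
  edge_scale *: (flattener x *m polar_factor (flattener x *m x)).

Lemma flattener_ker x Q : admissible x -> polar (flattener x *m x) Q ->
  forall w : 'rV[R]_N, w *m (flattener x *m x *m Q^T) = 0 ->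
    w *m flattener x = 0.
Proof.
move=> gx; have [a -> ha] := flattener_compress n2 gx => pol w.
exact: (polar_ker n0 gx (flattener_apex n2 gx ha) pol).
Qed.

(** Independence of the chosen polar factor, on which equivariance rests. *)
Lemma model_uniq x Q : admissible x -> polar (flattener x *m x) Q ->
  model x = edge_scale *: (flattener x *m Q).
Proof.
move=> gx pol; congr (_ *: _); apply: polar_uniq (polar_factorP _) pol _ => w.
by rewrite flattener_tr; apply: flattener_ker; [|exact: polar_factorP].
Qed.

Lemma polar_orthogonal (O : 'M[R]_N) (Y Q : 'M[R]_(N, n)) : O^T *m O = 1%:M ->
  polar Y Q -> polar (O *m Y) (O *m Q).
Proof.
move=> o [oQ [sT pT]].
have e : O *m Y *m (O *m Q)^T = O *m (Y *m Q^T) *m O^T by rewrite trmx_mul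
  !mulmxA.
split; first by rewrite trmx_mul mulmxA -[_ *m O]mulmxA o mulmx1.
split; first by rewrite e !trmx_mul trmxK -trmx_mul sT !mulmxA.
by move=> w; rewrite e !mulmxA -mulmxA -trmx_mul -[_ *m Y *m _]mulmxA.
Qed.

Lemma perm_mx_orthogonal (s : 'S_N) : (perm_mx s)^T *m perm_mx s = 1%:M :>
  'M[R]_N.
Proof. by rewrite tr_perm_mx -perm_mxM mulVg perm_mx1. Qed.

Lemma model_row_perm x (s : 'S_N) : admissible x ->
  model (row_perm s x) = row_perm s (model x).
Proof.
move=> gx; have Dx : flattener (row_perm s x) *m row_perm s x =
    perm_mx s *m (flattener x *m x).
  rewrite flattener_row_perm row_permE !mulmxA.
  by rewrite -[_ *m _^T *m perm_mx s]mulmxA perm_mx_orthogonal mulmx1.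
have Dpol Y : Y = perm_mx s *m (flattener x *m x) ->
    polar Y (perm_mx s *m polar_factor (flattener x *m x)).
  by move=> ->; apply: polar_orthogonal (perm_mx_orthogonal s) (polar_factorP
    _).
rewrite (model_uniq (admissible_row_perm gx) (Dpol _ Dx)).
rewrite /model [RHS]row_permE -scalemxAr; congr (_ *: _).
rewrite flattener_row_perm !mulmxA.
by rewrite -[_ *m _^T *m perm_mx s]mulmxA perm_mx_orthogonal mulmx1.
Qed.

(** The barycentric weights of a path that runs along two consecutive
    segments.  They are clamped to be defined for every real time. *)
Definition weight0 (t : R) : R := Num.max 0 (Num.min 1 (1 - 2 * t)).
Definition weight2 (t : R) : R := Num.max 0 (Num.min 1 (2 * t - 1)).
Definition weight1 t : R := 1 - weight0 t - weight2 t.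

Definition retraction (t : R) x : 'M[R]_(N, n) :=
  weight0 t *: x
  + weight1 t *: (flattener x *m x + (1%:M - flattener x) *m model x)
  + weight2 t *: model x.

Lemma weightP t : [/\ 0 <= weight0 t, 0 <= weight1 t, 0 <= weight2 t &
  weight0 t * weight2 t = 0].
Proof.
have w0 : 0 <= weight0 t by rewrite le_max lexx.
have w2 : 0 <= weight2 t by rewrite le_max lexx.
rewrite /weight1; have [t1|t1] := leP (2 * t) 1.
  have e2 : weight2 t = 0.
    by apply: max_l; rewrite ge_min; apply/orP; right; lra.
  have : weight0 t <= 1 by rewrite /weight0 ge_max ler01 /= ge_min lexx.
  by rewrite e2 mulr0 => ?; split=> //; lra.
have e0 : weight0 t = 0.
  by apply: max_l; rewrite ge_min; apply/orP; right; lra.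
have : weight2 t <= 1 by rewrite /weight2 ge_max ler01 /= ge_min lexx.
by rewrite e0 mul0r => ?; split=> //; lra.
Qed.

Lemma retraction_admissible t x : admissible x -> admissible (retraction t x).
Proof.
move=> gx; rewrite /retraction /model; have [a De ha] :=
  flattener_compress n2 gx.
rewrite De; have [w0 w1 w2 w02] := weightP t.
apply: (path_admissible n0 gx _ edge_scale_gt0 (flattener_apex n2 gx ha)
  (polar_factorP _)) => //.
- by rewrite height_ratio_ge0 height_ratio_le1.
- by rewrite /weight1; ring.
Qed.

Lemma retraction0 x : retraction 0 x = x.
Proof.
have e0 : weight0 0 = 1.
  by rewrite /weight0 mulr0 subr0 min_l // max_r // ler01.
have e2 : weight2 0 = 0.
  by rewrite /weight2 mulr0 sub0r max_l // ge_min; apply/orP; right; lra.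
by rewrite /retraction /weight1 e0 e2 !subrr !scale0r scale1r !addr0.
Qed.

Lemma retraction1 x : retraction 1 x = model x.
Proof.
have e2 : weight2 1 = 1.
  rewrite /weight2 mulr1; have -> : 2 - 1 = 1 :> R by ring.
  by rewrite min_l // max_r // ler01.
have e0 : weight0 1 = 0.
  by rewrite /weight0 mulr1 max_l // ge_min; apply/orP; right; lra.
by rewrite /retraction /weight1 e0 e2 subr0 subrr !scale0r scale1r !add0r.
Qed.

Lemma retraction_model t x : model x = x -> retraction t x = x.
Proof.
move=> e; rewrite /retraction e mulmxBl mul1mx addrC [_ *m x + _]addrC subrK.
by rewrite -!scalerDl /weight1 -[RHS]scale1r; congr (_ *: _); ring.
Qed.

Lemma mulmx_conj (P D : 'M[R]_N) (A : 'M[R]_(N, n)) : P^T *m P = 1%:M ->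
  (P *m D *m P^T) *m (P *m A) = P *m (D *m A).
Proof. by move=> PP; rewrite mulmxA -[_ *m P]mulmxA PP mulmx1 mulmxA. Qed.

Lemma retraction_row_perm t x (s : 'S_N) : admissible x ->
  retraction t (row_perm s x) = row_perm s (retraction t x).
Proof.
move=> gx; rewrite /retraction model_row_perm // flattener_row_perm.
move: (model x) (flattener x) => A D; rewrite !row_permE.
move: (perm_mx s) (perm_mx_orthogonal s) => P PP.
rewrite (mulmx_conj _ _ PP) [(1%:M - P *m D *m P^T) *m _]mulmxBl mul1mx.
rewrite (mulmx_conj _ _ PP) -mulmxBr.
have -> : A - D *m A = (1%:M - D) *m A by rewrite mulmxBl mul1mx.
by rewrite -mulmxDr !scalemxAr -!mulmxDr.
Qed.

End Model.

(** * Continuity of the deformation *)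

Section Squeeze.
Context {R : realType} {T : Type} {F : set_system T} {FF : Filter F}.

Lemma cvg0_dominated (u b : T -> R) : (forall t, `|u t| <= b t) ->
  b t @[t --> F] --> 0 -> u t @[t --> F] --> 0.
Proof.
move=> ub b0; apply: (@squeeze_cvgr _ _ _ _ (fun t => - b t) b).
- by apply: nearW => t; rewrite -ler_norml.
- by rewrite -oppr0; apply: cvgN.
- exact: b0.
Qed.

Lemma cvg_sqrt (u : T -> R) (a : R) : u t @[t --> F] --> a ->
  Num.sqrt (u t) @[t --> F] --> Num.sqrt a.
Proof.
by move=> h; apply: (@cvg_comp _ _ _ u (fun y : R => Num.sqrt y) F _ _ h);
  exact: sqrt_continuous.
Qed.

Lemma cvg_minr (u v : T -> R) (a b : R) : u t @[t --> F] --> a ->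
  v t @[t --> F] --> b -> Num.min (u t) (v t) @[t --> F] --> Num.min a b.
Proof.
move=> hu hv; under eq_fun do rewrite minr_absE; rewrite minr_absE.
apply: cvgM; last exact: cvg_cst; apply: cvgB; first exact: cvgD.
by apply: cvg_norm; apply: cvgB.
Qed.

Lemma cvg_maxr (u v : T -> R) (a b : R) : u t @[t --> F] --> a ->
  v t @[t --> F] --> b -> Num.max (u t) (v t) @[t --> F] --> Num.max a b.
Proof.
move=> hu hv; under eq_fun do rewrite maxr_absE; rewrite maxr_absE.
apply: cvgM; last exact: cvg_cst; apply: cvgD; first exact: cvgD.
by apply: cvg_norm; apply: cvgB.
Qed.

Lemma cvg_bigmin (I : Type) (r : seq I) (P : pred I) (u : T -> R) (a : R)
    (f : I -> T -> R) (g : I -> R) : u t @[t --> F] --> a ->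
  (forall i, P i -> f i t @[t --> F] --> g i) ->
  \big[Num.min/u t]_(i <- r | P i) f i t @[t --> F] -->
    \big[Num.min/a]_(i <- r | P i) g i.
Proof.
move=> hu hf; elim: r => [|i r IH].
  by under eq_fun do rewrite big_nil; rewrite big_nil.
under eq_fun do rewrite big_cons; rewrite big_cons.
by case: ifP => // Pi; apply: cvg_minr => //; exact: hf.
Qed.

End Squeeze.

Section Continuity.
Context {R : realType} {n : nat}.
Hypothesis n2 : (2 <= n)%N.
Local Notation N := n.+1.
Context {T : Type} {F : set_system T} {FF : Filter F}.
Variables (X : T -> 'M[R]_(N, n)) (x : 'M[R]_(N, n)).
Hypothesis Xx : X t @[t --> F] --> x.

Lemma cvg_facet_normals : facet_normals (X t) @[t --> F] --> facet_normals x.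
Proof.
apply: cvg_mx => i k; under eq_fun do rewrite mxE; rewrite mxE.
apply: cvgM; first exact: cvg_cst; apply: cvg_det; apply: cvg_mx => p q.
under eq_fun do rewrite !mxE; rewrite !mxE.
by case: unlift => [l|]; [apply: cvg_entry | exact: cvg_cst].
Qed.

Lemma cvg_area i : area (X t) i @[t --> F] --> area x i.
Proof.
apply: cvg_sqrt; apply: cvg_entry; apply: cvg_mulmx; apply: cvg_mx => p q.
  under eq_fun do rewrite mxE; rewrite mxE; apply: cvg_entry.
  exact: cvg_facet_normals.
under eq_fun do rewrite 2!mxE; rewrite 2!mxE; apply: cvg_entry.
exact: cvg_facet_normals.
Qed.

Lemma cvg_sqr_area i : area (X t) i ^+ 2 @[t --> F] --> area x i ^+ 2.
Proof.
under eq_fun do rewrite expr2; rewrite expr2.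
by apply: cvgM; exact: cvg_area.
Qed.

Lemma cvg_excess a : excess (X t) a @[t --> F] --> excess x a.
Proof.
apply: cvgB; last exact: cvg_sqr_area.
under eq_fun do rewrite expr2; rewrite expr2.
by apply: cvgM; apply: cvg_sumr => b _; exact: cvg_area.
Qed.

Lemma cvg_gap a : gap (X t) a @[t --> F] --> gap x a.
Proof.
apply: cvg_bigmin => [|b _]; first exact: cvg_sqr_area.
apply: cvg_maxr; first exact: cvg_cst.
by apply: cvgB; exact: cvg_sqr_area.
Qed.

Hypothesis gx : admissible x.

Lemma cvg_height_ratio a : height_ratio (X t) a @[t --> F] --> height_ratio x a.
Proof.
apply: cvg_sqrt; apply: cvgM; first exact: cvg_excess.
apply: cvgV; first by rewrite gt_eqF // denom_gt0.
apply: cvgD; first exact: cvg_excess.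
by apply: cvgM; [exact: cvg_cst | exact: cvg_gap].
Qed.

Lemma cvg_flattener : flattener (X t) @[t --> F] --> flattener x.
Proof.
apply: cvg_mx => i j; under eq_fun do rewrite flattenerE; rewrite flattenerE.
apply: cvgB; first exact: cvg_cst; apply: cvg_sumr => a _.
apply: cvgM; last exact: cvg_cst.
by apply: cvgB; [exact: cvg_cst | exact: cvg_height_ratio].
Qed.

(** Write [Z] for the difference of two polar factors.  By [polar_dist] and
    the inequality of Cauchy and Schwarz, [S *m Z] tends to 0, where [S] is
    the positive part at the limit point; hence so does [flattener x *m Z],
    as the kernel of [S] is contained in that of [flattener x]. *)
Lemma cvg_model : model (X t) @[t --> F] --> model x.
Proof.
pose Y := flattener x *m x; pose Q := polar_factor Y.
pose Yt t := flattener (X t) *m X t; pose Qt t := polar_factor (Yt t).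
have pQ : polar Y Q := polar_factorP _.
have pQt t : polar (Yt t) (Qt t) := polar_factorP _.
pose S := Y *m Q^T; have [sS pS] : sympsd S := proj2 pQ.
have cY : Yt t @[t --> F] --> Y by apply: cvg_mulmx => //; exact: cvg_flattener.
pose Z t := Q - Qt t.
have Z2 t i j : `|Z t i j| <= 2.
  rewrite mxE [X in _ + X]mxE; apply: le_trans (ler_normD _ _) _;
    rewrite normrN.
  by have := orthonormal_entry_le1 i j (proj1 pQ); have :=
    orthonormal_entry_le1 i j (proj1 (pQt t)); lra.
pose d t := \sum_i \sum_j `|Y i j - Yt t i j|.
have d0 : d t @[t --> F] --> 0.
  have -> : 0 = \sum_(i < N) \sum_(j < n) `|Y i j - Y i j| :> R.
    by rewrite big1 // => i _; rewrite big1 // => j _; rewrite subrr normr0.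
  apply: cvg_sumr => i _; apply: cvg_sumr => j _; apply: cvg_norm.
  by apply: cvgB; [exact: cvg_cst | exact: cvg_entry].
have trd t : \tr ((Z t)^T *m S *m Z t) <= 4 * d t.
  apply: le_trans (polar_dist pQ (pQt t)) _; rewrite -/Q -/(Z t).
  have -> : 4 * d t = 2 * (2 * d t) by ring.
  rewrite ler_pM2l ?ltr0n // /d mulr_sumr /mxtrace.
  under eq_bigr do rewrite mxE.
  rewrite exchange_big /=; apply: ler_sum => i _; rewrite mulr_sumr.
  apply: ler_sum => j _; rewrite mxE [X in _ * X]mxE [X in _ * (_ + X)]mxE.
  by apply: le_trans (ler_norm _) _; rewrite normrM ler_wpM2r.
have SZ : (S *m Z t) @[t --> F] --> (0 : 'M[R]_(N, n)).
  apply: cvg_mx => i j; rewrite mxE.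
  apply: (@cvg0_dominated _ _ _ _ _ (fun t => Num.sqrt (S i i * (4 * d t))));
    last first.
    rewrite -sqrtr0; apply: cvg_sqrt; rewrite -(mulr0 (S i i)).
    apply: cvgM; first exact: cvg_cst; rewrite -(mulr0 4).
    by apply: cvgM; [exact: cvg_cst | exact: d0].
  move=> t; rewrite -sqrtr_sqr ler_wsqrtr //.
  have Ei : ((delta_mx 0 i : 'rV[R]_N) *m S *m (delta_mx 0 i : 'rV[R]_N)^T) 0 0
    = S i i.
    exact: form_delta.
  have Eij : ((delta_mx 0 i : 'rV[R]_N) *m S *m (row j (Z t)^T)^T) 0 0 = (S *m
    Z t) i j.
    rewrite -rowE tr_row trmxK mxE [RHS]mxE.
    by apply: eq_bigr => k _; rewrite mxE [X in _ * X]mxE.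
  have := psd_CS (delta_mx 0 i) (row j (Z t)^T) (proj2 pQ).
  rewrite -/S Eij Ei => h; apply: le_trans h _.
  apply: ler_wpM2l.
    by have := pS (delta_mx 0 i); rewrite Ei.
  apply: le_trans (trd t).
  by have := psd_row_le_tr (Z t)^T j pS; rewrite trmxK.
have [E DE] : exists E, flattener x = S *m E.
  by apply: ker_factor => // w; exact: (flattener_ker n2 gx pQ).
have DZ : (flattener x *m Z t) @[t --> F] --> (0 : 'M[R]_(N, n)).
  rewrite -(flattener_tr x) DE trmx_mul sS -(mulmx0 _ E^T).
  under eq_fun do rewrite -mulmxA.
  by apply: cvg_mulmx => //; exact: cvg_cst.
have DQ : ((flattener (X t) - flattener x) *m Qt t) @[t --> F] -->
  (0 : 'M[R]_(N, n)).
  apply: cvg_mx => i j; rewrite mxE.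
  pose b t := \sum_k `|flattener (X t) i k - flattener x i k|.
  apply: (@cvg0_dominated _ _ _ _ _ b); last first.
    have -> : 0 = \sum_(k < N) `|flattener x i k - flattener x i k| :> R.
      by rewrite big1 // => k _; rewrite subrr normr0.
    apply: cvg_sumr => k _; apply: cvg_norm.
    apply: cvgB; last exact: cvg_cst.
    by apply: cvg_entry; exact: cvg_flattener.
  move=> t; rewrite mxE; apply: le_trans (ler_norm_sum _ _ _) _;
    apply: ler_sum => k _.
  rewrite normrM mxE [X in `|_ + X|]mxE ler_piMr //.
  exact: orthonormal_entry_le1 (proj1 (pQt t)).
have e t : model (X t) = model x - edge_scale *: (flattener x *m Z t)
    + edge_scale *: ((flattener (X t) - flattener x) *m Qt t).
  have alg (D D' : 'M[R]_N) (A B : 'M[R]_(N, n)) : edge_scale *: (D' *m B) =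
      edge_scale *: (D *m A) - edge_scale *: (D *m (A - B)) + edge_scale *:
        ((D' - D) *m B).
    by rewrite mulmxBr mulmxBl -scalerBr -scalerDr subKr addrC subrK.
  exact: alg.
under eq_fun do rewrite e.
have -> : model x = model x - edge_scale *: (0 : 'M[R]_(N,
  n)) + edge_scale *: (0 : 'M[R]_(N, n)).
  by rewrite !scaler0 subr0 addr0.
apply: cvgD.
  by apply: cvgB; [rewrite !scaler0 subr0 addr0; exact: cvg_cst | apply: cvgZr].
exact: cvgZr.
Qed.

Lemma cvg_weight0 (tau : T -> R) s : tau t @[t --> F] --> s ->
  weight0 (tau t) @[t --> F] --> weight0 s.
Proof.
move=> h; apply: cvg_maxr; first exact: cvg_cst.
apply: cvg_minr; first exact: cvg_cst.
by apply: cvgB; [exact: cvg_cst | apply: cvgM => //; exact: cvg_cst].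
Qed.

Lemma cvg_weight2 (tau : T -> R) s : tau t @[t --> F] --> s ->
  weight2 (tau t) @[t --> F] --> weight2 s.
Proof.
move=> h; apply: cvg_maxr; first exact: cvg_cst.
apply: cvg_minr; first exact: cvg_cst.
by apply: cvgB; [apply: cvgM => //; exact: cvg_cst | exact: cvg_cst].
Qed.

Lemma cvg_retraction (tau : T -> R) s : tau t @[t --> F] --> s ->
  retraction (tau t) (X t) @[t --> F] --> retraction s x.
Proof.
move=> h; have h0 := cvg_weight0 h; have h2 := cvg_weight2 h.
have D := cvg_flattener; have M := cvg_model.
apply: cvgD; last exact: cvgZ.
apply: cvgD; first exact: cvgZ.
apply: cvgZ; first by apply: cvgB => //; apply: cvgB => //; exact: cvg_cst.
apply: cvgD; apply: cvg_mulmx => //.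
by apply: cvgB => //; exact: cvg_cst.
Qed.

End Continuity.

(** * Gram matrices of pyramids *)

Section Pyramids.
Context {R : realType} {n : nat}.
Hypothesis n2 : (2 <= n)%N.
Local Notation N := n.+1.
Implicit Types (x : 'M[R]_(N, n)) (a b i j : 'I_N) (k : R).

Let n0 : (0 < n)%N. Proof. exact: ltnW. Qed.
Let nR0 : n%:R != 0 :> R. Proof. by rewrite pnatr_eq0 -lt0n. Qed.
Let NR : N%:R = n%:R + 1 :> R. Proof. by rewrite -natr1. Qed.
Let nR1 : n%:R + 1 != 0 :> R. Proof. by rewrite -NR pnatr_eq0. Qed.

Lemma gramE x i j : dotp (row i x) (row j x) = (x *m x^T) i j.
Proof. by rewrite mxE; apply: eq_bigr => l _; rewrite !mxE. Qed.

Lemma dotpC (u v : 'rV[R]_n) : dotp u v = dotp v u.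
Proof. by apply: eq_bigr => k _; rewrite mulrC. Qed.

Lemma dotpBB (u v u' v' : 'rV[R]_n) : dotp (u - v) (u' - v') =
  dotp u u' - dotp u v' - dotp v u' + dotp v v'.
Proof.
rewrite /dotp -!sumrB -big_split /=; apply: eq_bigr => k _.
by rewrite !mxE; ring.
Qed.

Lemma dotpBr (u v w : 'rV[R]_n) : dotp u (v - w) = dotp u v - dotp u w.
Proof.
by rewrite /dotp -sumrB; apply: eq_bigr => k _; rewrite !mxE; ring.
Qed.

Lemma dotpZl t (u v : 'rV[R]_n) : dotp (t *: u) v = t * dotp u v.
Proof. by rewrite /dotp mulr_sumr; apply: eq_bigr => k _;
  rewrite mxE mulrA. Qed.

Lemma dotp_ge0 (u : 'rV[R]_n) : 0 <= dotp u u.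
Proof. by apply: sumr_ge0 => k _; rewrite -expr2 sqr_ge0. Qed.

Lemma edist_sqr (u v : 'rV[R]_n) : edist u v ^+ 2 = dotp (u - v) (u - v).
Proof. by rewrite sqr_sqrtr // dotp_ge0. Qed.

Lemma compress_entry a k i j : compress a k i j =
  (i == j)%:R - N%:R^-1
  - (1 - k) * (N%:R / n%:R * (((i == a)%:R - N%:R^-1) * ((a == j)%:R -
    N%:R^-1))).
Proof.
by rewrite compress_def mxE [X in _ + X]mxE [X in _ - X]mxE axisE !centeringE.
Qed.

Definition centered x := \sum_i row i x = 0.

Lemma apex_minus_base x a : centered x ->
  row a x - barycenter [set~ a]%SET x = (N%:R / n%:R) *: row a x.
Proof.
rewrite /centered (bigD1 a) //= => /eqP; rewrite addrC addr_eq0 => /eqP e.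
rewrite /barycenter cardsC1 card_ord.
have -> : \sum_(i in [set~ a]%SET) row i x = \sum_(i | i != a) row i x.
  by apply: eq_bigl => i; rewrite !inE.
rewrite e scalerN opprK -{1}[row a x]scale1r -scalerDl; congr (_ *: _).
by rewrite NR; field.
Qed.

Lemma barycenter_all x : barycenter [set: 'I_N]%SET x = N%:R^-1 *: \sum_i row i
  x.
Proof.
by rewrite /barycenter cardsT card_ord; congr (_ *: _); apply: eq_bigl => i;
  rewrite inE.
Qed.

Lemma barycenter0 x : barycenter [set: 'I_N]%SET x = 0 <-> centered x.
Proof.
rewrite barycenter_all /centered; split=> [/eqP|->]; last by rewrite scaler0.
by rewrite scaler_eq0 invr_eq0 pnatr_eq0 => /eqP.
Qed.

Lemma height_sqr x a : centered x ->
  height a x ^+ 2 = (N%:R / n%:R) ^+ 2 * (x *m x^T) a a.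
Proof.
move=> cx; rewrite /height edist_sqr apex_minus_base // dotpZl dotpC dotpZl
  gramE.
by rewrite mulrA -expr2.
Qed.

Lemma regular_height_sqr : regular_height R n ^+ 2 = N%:R / (2 * n%:R).
Proof. by rewrite sqr_sqrtr // divr_ge0 // mulr_ge0. Qed.

Lemma regular_height_gt0 : 0 < regular_height R n.
Proof. by rewrite sqrtr_gt0 divr_gt0 // mulr_gt0 // ltr0n. Qed.

Lemma pyramid_of_gram x a k : 0 <= k <= 1 ->
  x *m x^T = 2^-1 *: compress a (k ^+ 2) -> pyramid a x.
Proof.
move=> /andP[k0 k1] G.
have GE i j : (x *m x^T) i j = 2^-1 * compress a (k ^+ 2) i j by rewrite G mxE.
have cx : centered x.
  pose u : 'rV[R]_N := const_mx 1.
  have ux : u *m x = 0.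
    apply: sqnorm_eq0; rewrite trmx_mul mulmxA -[u *m x *m x^T]mulmxA G
      -scalemxAr -scalemxAl mxE.
    have -> : (u *m compress a (k ^+ 2) *m u^T) 0 0 = \sum_i (u *m compress a
      (k ^+ 2)) 0 i.
      by rewrite mxE; apply: eq_bigr => i _; rewrite [u^T _ _]mxE [u _ _]mxE
        mulr1.
    by rewrite (compress_sum n0) mulr0.
  rewrite /centered -[RHS]ux; apply/rowP => l; rewrite summxE mxE;
    apply: eq_bigr => i _.
  by rewrite [u _ _]mxE mul1r mxE.
split.
- move=> i j ia ja ij; rewrite /edist dotpBB !gramE !GE !compress_entry !eqxx.
  rewrite (negbTE ia) (eq_sym a) (negbTE ia) (negbTE ja) (eq_sym a) (negbTE ja).
  rewrite (eq_sym j) (negbTE ij) NR -[RHS]sqrtr1; congr Num.sqrt => /=; field.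
  by rewrite ?nR0 ?nR1.
- move=> i j ia ja; rewrite apex_minus_base // dotpZl.
  rewrite dotpBr !gramE.
  by rewrite !GE !compress_entry !eqxx (eq_sym a i) (negbTE ia) (eq_sym a j)
    (negbTE ja); ring.
- have h0 : 0 <= height a x by exact: sqrtr_ge0.
  have hE : height a x ^+ 2 = (k * regular_height R n) ^+ 2.
    rewrite height_sqr // GE compress_entry !eqxx [in RHS]exprMn
      regular_height_sqr NR /=.
    by field; rewrite ?nR0 ?nR1.
  have -> : height a x = k * regular_height R n.
    apply/eqP; rewrite -(@eqrXn2 _ 2) ?hE //.
    by rewrite mulr_ge0 // ltW // regular_height_gt0.
  have r0 := regular_height_gt0.
  by apply/andP; split; [rewrite mulr_ge0 // ltW | rewrite ler_piMl // ltW].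
- exact/barycenter0.
Qed.

(** Centring and the orthogonality of the axis to the base determine the
    row of the apex in terms of its diagonal entry [g]; the unit edges and
    the vanishing of the row sums then determine the other entries. *)
Lemma gram_of_pyramid x a : pyramid a x -> exists2 k, 0 <= k <= 1 &
  x *m x^T = 2^-1 *: compress a (k ^+ 2).
Proof.
move=> [edge perp /andP[h0 h1] /barycenter0 cx].
have r0 := regular_height_gt0.
exists (height a x / regular_height R n).
  by rewrite divr_ge0 ?(ltW r0) //= ler_pdivrMr // mul1r.
have := height_sqr a cx; set g := (x *m x^T) a a => hg.
have Gsym i j : (x *m x^T) i j = (x *m x^T) j i by rewrite -!gramE dotpC.
have rows i : \sum_j (x *m x^T) i j = 0.
  have -> : \sum_j (x *m x^T) i j = dotp (row i x) (\sum_j row j x).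
    rewrite /dotp; under [RHS]eq_bigr do rewrite summxE mulr_sumr.
    by rewrite exchange_big /=; apply: eq_bigr => j _; rewrite -gramE.
  by rewrite cx /dotp big1 // => l _; rewrite [X in _ * X]mxE mulr0.
have Gaeq i j : i != a -> j != a -> (x *m x^T) a i = (x *m x^T) a j.
  move=> ia ja; have := perp i j ia ja; rewrite apex_minus_base // dotpZl.
  move=> /eqP; rewrite mulf_eq0 mulf_eq0 invr_eq0 (negbTE nR0) pnatr_eq0 /= =>
    /eqP e.
  by apply/eqP; rewrite -subr_eq0 -!gramE -dotpBr e.
have cardF : \sum_(j | j != a) (1 : R) = n%:R.
  rewrite sumr_const; congr (_ *+ _).
  by have := cardC1 a; rewrite card_ord.
have Ga i : i != a -> (x *m x^T) a i = - g / n%:R.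
  move=> ia; have := rows a; rewrite (bigD1 a) //= -/g.
  have -> : \sum_(j | j != a) (x *m x^T) a j = n%:R * (x *m x^T) a i.
    rewrite -cardF mulr_suml; apply: eq_bigr => j ja; rewrite mul1r;
      exact: Gaeq.
  by move=> e; apply: (mulfI nR0); rewrite mulrCA divff // mulr1; lra.
have dij i j : i != a -> j != a -> i != j ->
    (x *m x^T) i j = ((x *m x^T) i i + (x *m x^T) j j - 1) / 2.
  move=> ia ja ij; have := edist_sqr (row i x) (row j x).
  rewrite edge // expr1n dotpBB !gramE (Gsym j i) => e; lra.
pose S := \sum_(j | j != a) (x *m x^T) j j.
have diag i : i != a -> n%:R * (x *m x^T) i i = n%:R - 1 - S + 2 * g / n%:R.
  move=> ia; have := rows i; rewrite (bigD1 a) //= (bigD1 i) //= Gsym Ga //.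
  under eq_bigr => j /andP[ja ji] do rewrite dij // 1?eq_sym //.
  have SE : S = (x *m x^T) i i + \sum_(j | (j != a) && (j != i)) (x *m x^T) j j.
    by rewrite /S (bigD1 i).
  have nE : n%:R = 1 + \sum_(j | (j != a) && (j != i)) (1 : R).
    by rewrite -cardF (bigD1 i).
  rewrite -mulr_suml sumrB big_split /= => e.
  have e3 : \sum_(j | (j != a) && (j != i)) (x *m x^T) i i =
      (n%:R - 1) * (x *m x^T) i i.
    by rewrite nE addrC addKr mulr_suml; apply: eq_bigr => j _; rewrite mul1r.
  have e1 : \sum_(j | (j != a) && (j != i)) (1 : R) = n%:R - 1 by rewrite nE;
    ring.
  have e2 : \sum_(j | (j != a) && (j != i)) (x *m x^T) j j = S - (x *m x^T) i i.
    by rewrite SE; ring.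
  rewrite e1 e2 e3 in e; have : - g / n%:R = - (g / n%:R) by ring.
  lra.
have SE : S = (n%:R - 1) / 2 + g / n%:R.
  have : n%:R * S = n%:R * (n%:R - 1 - S + 2 * g / n%:R).
    rewrite {1}/S mulr_sumr (eq_bigr _ diag).
    by rewrite -[X in _ = X * _]cardF mulr_suml; apply: eq_bigr => j _;
      rewrite mul1r.
  move=> /(mulfI nR0) e; lra.
have Gii i : i != a -> (x *m x^T) i i = (n%:R - 1) / (2 * n%:R) + g / n%:R ^+ 2.
  move=> /diag; rewrite SE => e; apply: (mulfI nR0); rewrite e; field.
  by rewrite ?nR0 ?nR1.
set k2 := (_ / _) ^+ 2.
have gE : g = k2 * n%:R / (2 * N%:R).
  rewrite /k2 expr_div_n hg regular_height_sqr NR; field.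
  by rewrite ?nR0 ?nR1.
apply/matrixP => i j; rewrite [RHS]mxE compress_entry.
have [->|ia] := eqVneq i a.
  have [->|ja] := eqVneq j a; first by rewrite -/g gE ?eqxx NR /=; field;
    rewrite ?nR0 ?nR1.
  by rewrite Ga // gE ?eqxx NR /=; field; rewrite ?nR0 ?nR1.
have [->|ja] := eqVneq j a.
  by rewrite Gsym Ga // gE ?eqxx (negbTE ia) NR /=; field; rewrite ?nR0 ?nR1.
have [->|ij] := eqVneq i j.
  by rewrite Gii // gE ?eqxx NR /=; field; rewrite ?nR0 ?nR1.
by rewrite dij // !Gii // gE ?eqxx NR /=; field; rewrite ?nR0 ?nR1.
Qed.

End Pyramids.

Section ModelPyramid.
Context {R : realType} {n : nat}.
Hypothesis n2 : (2 <= n)%N.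
Local Notation N := n.+1.
Implicit Types (x : 'M[R]_(N, n)) (a b i j : 'I_N) (k : R).

Let n0 : (0 < n)%N. Proof. exact: ltnW. Qed.
Let nR0 : n%:R != 0 :> R. Proof. by rewrite pnatr_eq0 -lt0n. Qed.
Let NR : N%:R = n%:R + 1 :> R. Proof. by rewrite -natr1. Qed.
Let nR1 : n%:R + 1 != 0 :> R. Proof. by rewrite -NR pnatr_eq0. Qed.

Lemma model_pyramid x : admissible x -> exists a, pyramid a (model x).
Proof.
move=> gx; have [a De ha] := flattener_compress n2 gx; exists a.
apply: (@pyramid_of_gram _ _ n2 _ _ (height_ratio x a)).
  by rewrite height_ratio_ge0 height_ratio_le1.
have pol := polar_factorP (compress a (height_ratio x a) *m x).
by rewrite /model De (compress_gram n0 edge_scale gx (flattener_apex n2 gx ha)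
  pol) edge_scale_sqr.
Qed.

Lemma compress_const1 a k : compress a k *m (const_mx 1 : 'cV[R]_N) = 0.
Proof.
apply/matrixP => i j; rewrite mxE [RHS]mxE.
have := compress_sum n0 (delta_mx 0 i) a k; rewrite -rowE => e.
by rewrite -[RHS]e; apply: eq_bigr => l _; rewrite [X in _ * X]mxE mulr1 mxE.
Qed.

(** The cofactor identities say that the Gram matrix of the normals is, up
    to the squared determinant, the inverse of that of [x] on the vectors of
    zero sum. *)
Lemma facet_gram x a k : k != 0 -> x *m x^T = 2^-1 *: compress a (k ^+ 2) ->
  facet_normals x *m (facet_normals x)^T =
    (2 * \det (aug x) ^+ 2) *: compress a (k ^- 2).
Proof.
move=> k_n0 G; set W := facet_normals x; set d := \det (aug x).
have [u e] := mul_facet_normals x; rewrite -/W -/d in e.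
have GC : x *m x^T *m (W *m W^T) = d *: (d%:M - const_mx 1 *m u).
  have xW : x^T *m W = d%:M.
    by apply: trmx_inj; rewrite trmx_mul trmxK tr_scalar_mx /W
      facet_normals_tr_mul.
  rewrite mulmxA -[x *m x^T *m W]mulmxA xW mul_mx_scalar -scalemxAl e.
  by [].
have cW : centering *m W = W.
  apply/matrixP => i l; rewrite centering_def mulmxBl mul1mx -scalemxAl mxE.
  rewrite [X in _ + X]mxE [X in _ - X]mxE.
  have -> : ((const_mx 1 : 'M[R]_N) *m W) i l = 0.
    rewrite mxE -[RHS](facet_normals_sum x l); apply: eq_bigr => j _.
    by rewrite mxE mul1r.
  by rewrite mulr0 subr0.
rewrite -{1}cW -mulmxA -(compress1 a).
have -> : compress a 1 = compress a (k ^- 2) *m compress a (k ^+ 2).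
  by rewrite (compress_mul n0) mulVf // expf_neq0.
rewrite -mulmxA.
have -> : compress a (k ^+ 2) = 2 *: (x *m x^T).
  by rewrite G scalerA mulfV ?scale1r // pnatr_eq0.
rewrite -scalemxAl GC -scalemxAr -scalemxAr mulmxBr mulmxA compress_const1
  mul0mx subr0.
by rewrite mul_mx_scalar !scalerA; congr (_ *: _); ring.
Qed.

Lemma area_sqr x i :
  area x i ^+ 2 = (facet_normals x *m (facet_normals x)^T) i i.
Proof.
by rewrite /area sqr_enorm mxE [RHS]mxE; apply: eq_bigr => l _; rewrite !mxE.
Qed.

Lemma height_ratio_solid x a k : admissible x -> 0 < k <= 1 ->
  x *m x^T = 2^-1 *: compress a (k ^+ 2) ->
  height_ratio x a = k /\ forall b, b != a -> height_ratio x b = 1.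
Proof.
move=> gx /andP[k0 k1] G; have k_n0 : k != 0 by rewrite gt_eqF.
have C := facet_gram k_n0 G.
set d2 := \det (aug x) ^+ 2 in C.
(* The squared areas of the base and of the other facets. *)
pose al := 2 * d2 * (k ^- 2 * (n%:R / N%:R)).
pose be := 2 * d2 * (n%:R / N%:R - (1 - k ^- 2) / (n%:R * N%:R)).
have Aa : area x a ^+ 2 = al.
  rewrite area_sqr C mxE compress_entry eqxx /al NR /=; field.
  by rewrite ?nR0 ?nR1 ?k_n0.
have Ab b : b != a -> area x b ^+ 2 = be.
  move=> ba; rewrite area_sqr C mxE compress_entry eqxx (eq_sym a b) (negbTE
    ba) /be NR /=.
  by field; rewrite ?nR0 ?nR1 ?k_n0.
have al0 : 0 < al by rewrite -Aa exprn_gt0 // area_gt0.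
have d2_n0 : d2 != 0.
  by apply: contraTneq al0 => e; rewrite /al e mulr0 mul0r ltxx.
have d20 : 0 < d2 by rewrite lt_neqAle eq_sym d2_n0 sqr_ge0.
have ab : al - be = 2 * d2 * ((k ^- 2 - 1) * ((n%:R - 1) / n%:R)).
  by rewrite /al /be NR; field; rewrite ?nR0 ?nR1 ?k_n0.
have nn : 1 < n%:R :> R by rewrite ltr1n.
have ab0 : be <= al.
  rewrite -subr_ge0 ab; apply: mulr_ge0; first by rewrite mulr_ge0 // ltW.
  apply: mulr_ge0; last by rewrite divr_ge0 // subr_ge0 ltW.
  by rewrite subr_ge0 invf_ge1 ?exprn_gt0 // exprn_ile1 // ltW.
have area_le b : area x b <= area x a.
  have [->//|ba] := eqVneq b a.
  by rewrite -ler_sqr ?nnegrE ?area_ge0 // Aa Ab.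
split; last first.
  move=> b ba; apply: height_ratio_eq1 => //; apply/eqP; apply: contraT => g.
  have g0 : 0 < gap x b by rewrite lt_neqAle eq_sym g gap_ge0.
  have := gap_gt0 g0 (_ : a != b); rewrite eq_sym => /(_ ba).
  by rewrite ltNge area_le.
have [b ba] := other_vertex a n0.
have be0 : 0 <= be by rewrite -(Ab b ba) sqr_ge0.
have gE : gap x a = al - be.
  apply/eqP; rewrite eq_le; apply/andP; split.
    rewrite /gap (bigD1 b) //= Aa Ab // ge_min; apply/orP; left.
    by rewrite max_r // subr_ge0.
  apply/bigmin_geP; split=> [|c ca]; first by rewrite Aa gerBl.
  by rewrite Aa Ab // le_max lexx orbT.
have eE : excess x a = n%:R ^+ 2 * be - al.
  rewrite /excess Aa; congr (_ - _).
  have -> : \sum_(c | c != a) area x c = n%:R * Num.sqrt be.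
    under eq_bigr => c ca do rewrite -[area x c]ger0_norm ?area_ge0 //
      -sqrtr_sqr Ab //.
    rewrite sumr_const -[Num.sqrt be *+ _]mulr_natl; congr (_%:R * _).
    by have := cardC1 a; rewrite card_ord.
  by rewrite exprMn sqr_sqrtr.
rewrite /height_ratio eE gE -[RHS]ger0_norm ?(ltW k0) // -sqrtr_sqr;
  congr Num.sqrt.
have -> : n%:R ^+ 2 * be - al + n%:R ^+ 2 * (al - be) = (n%:R ^+ 2 - 1) * al by
  ring.
have n1 : n%:R ^+ 2 - 1 != 0 :> R.
  by rewrite subr_eq0 gt_eqF // exprn_egt1.
have prod0 : (n%:R ^+ 2 - 1) * al != 0 by rewrite mulf_neq0 // gt_eqF.
apply: (mulIf prod0); rewrite divfK //.
by rewrite /al /be NR; field; rewrite ?nR0 ?nR1 ?k_n0.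
Qed.

Lemma height_ratio_collapsed x a : admissible x ->
  x *m x^T = 2^-1 *: compress a 0 ->
  height_ratio x a = 0 /\ forall b, b != a -> height_ratio x b = 1.
Proof.
move=> gx G; pose c : 'rV[R]_N := row a (axis a).
have dc : dependency x c.
  split; last by rewrite /c -axis_centering row_mul centering_sum.
  apply: sqnorm_eq0; rewrite trmx_mul mulmxA -[c *m x *m x^T]mulmxA G
    -scalemxAr -scalemxAl mxE.
  by rewrite compress0 /c -row_mul (axis_base n0) row0 mul0mx mxE mulr0.
have ce i : c 0 i = if i == a then n%:R / N%:R else - N%:R^-1.
  rewrite mxE axisE !centeringE eqxx eq_sym; case: eqP => _ /=; rewrite NR;
    field;
  by rewrite ?nR0 ?nR1.
have NR0 : 0 < N%:R :> R by rewrite ltr0n.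
have c0 : c != 0.
  apply/eqP => /rowP /(_ a); rewrite ce eqxx mxE => /eqP.
  by rewrite mulf_eq0 (negbTE nR0) invr_eq0 gt_eqF.
have ac : apical c a.
  move=> i ia; rewrite !ce eqxx (negbTE ia) mulNr oppr_lt0.
  by rewrite mulr_gt0 ?invr_gt0 // divr_gt0 // ltr0n.
have fa := height_ratio_flat n2 gx dc c0 ac.
split=> // b ba; apply: (height_ratio_lt1_unique n2 gx _ ba).
by rewrite fa eq_sym oner_eq0.
Qed.

(** [D x Q^T] and [edge_scale *: compress a (k ^+ 2)] are positive
    semidefinite with the same square, hence equal, and [D] is injective on
    its own image, which contains the columns of [x]. *)
Lemma model_fix x a : admissible x -> pyramid a x -> model x = x.
Proof.
move=> gx /(gram_of_pyramid n2)[k k01 G]; have [k0 k1] := andP k01.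
have [fa fb] : height_ratio x a = k /\ forall b, b != a -> height_ratio x b = 1.
  have [kz|k_n0] := eqVneq k 0.
    by rewrite kz; apply: height_ratio_collapsed => //; rewrite G kz expr0n.
  by apply: height_ratio_solid; rewrite // lt_neqAle eq_sym k_n0 k0.
have De : flattener x = compress a k.
  rewrite flattener_def compress_def (bigD1 a) //= big1 ?addr0 ?fa // => b ba.
  by rewrite fb // subrr scale0r.
rewrite /model De; set Q := polar_factor _; set D := compress a k.
have pQ : polar (D *m x) Q := polar_factorP _.
have TQ := polar_mulQ pQ; have sT := proj2 pQ.
have DT : D^T = D := compress_tr a k.
have Te : D *m x *m Q^T = edge_scale *: compress a (k ^+ 2).
  apply: psd_sqrt_uniq => //.
    have [s p] := compress_sympsd n0 a (exprn_ge0 2 k0); split.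
      by rewrite linearZ /= s.
    by move=> w; rewrite -scalemxAr -scalemxAl mxE mulr_ge0 // ltW //
      edge_scale_gt0.
  have -> : D *m x *m Q^T *m (D *m x *m Q^T) = D *m x *m (D *m x)^T.
    rewrite -{2}(proj1 sT) [(D *m x *m Q^T)^T]trmx_mul trmxK mulmxA.
    by rewrite -[_ *m Q^T *m Q]mulmxA (proj1 pQ) mulmx1.
  rewrite trmx_mul DT mulmxA -[D *m x *m x^T]mulmxA G.
  rewrite -!scalemxAr -!scalemxAl !(compress_mul n0) scalerA -expr2
    edge_scale_sqr.
  by congr (_ *: compress _ _); ring.
have [E xE] : exists E, x = D *m E.
  apply: ker_factor => // w wD.
  apply: sqnorm_eq0; rewrite trmx_mul mulmxA -[w *m x *m x^T]mulmxA G expr2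
    -(compress_mul n0).
  by rewrite -scalemxAr -scalemxAl mulmxA wD !mul0mx scaler0 mxE.
pose Z := edge_scale *: Q - E.
have e0 : D *m (D *m Z) = 0.
  rewrite /Z mulmxBr -xE mulmxBr -scalemxAr -scalemxAr -TQ Te.
  by rewrite -scalemxAl mulmxA (compress_mul n0) -expr2 subrr.
have e1 : D *m Z = 0.
  apply: trmx_inj; rewrite trmx0 -[LHS]mulmx1; apply: psd_tr0.
    exact: sympsd1.
  by rewrite mulmx1 trmxK trmx_mul DT -mulmxA e0 mulmx0 mxtrace0.
apply/eqP; rewrite [X in _ == X]xE -subr_eq0 scalemxAr -mulmxBr; apply/eqP;
  exact: e1.
Qed.

End ModelPyramid.

(** * Passage to unlabelled configurations *)

Section Configurations.
Context {R : realType} {n : nat}.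
Hypothesis n2 : (2 <= n)%N.
Local Notation K := (skeleton n.+1 (n - 2)).
Local Notation E := (embedding_space R n K).
Local Notation C := (config_space R n K).
Implicit Types (y z : E) (s : 'S_n.+1) (t : R).

Lemma embedding_admissible y : admissible (set_val y).
Proof. by apply/(embeddings_admissible _ n2); exact: set_mem (valP y). Qed.

Lemma mem_embeddings (x : 'M[R]_(n.+1, n)) : admissible x -> x \in embeddings K.
Proof. by move=> gx; apply: mem_set; apply/embeddings_admissible. Qed.

Definition embedding_of (x : 'M[R]_(n.+1, n)) (gx : admissible x) : E :=
  exist _ x (mem_embeddings gx).

Definition permute s y : E := embedding_of (@admissible_row_perm _ _ _ s
  (@embedding_admissible y)).

Definition retract t y : E :=
  embedding_of (@retraction_admissible _ _ n2 t _ (@embedding_admissible y)).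

Lemma set_val_continuous : continuous (set_val : E -> 'M[R]_(n.+1, n)).
Proof. exact: initial_continuous. Qed.

Lemma config_classP y z :
  config_class y = config_class z <-> exists s, z = permute s y.
Proof.
split=> [/eqquotP/existsP[s /eqP e]|[s ->]].
  by exists s; apply: val_inj.
by apply/eqquotP/existsP; exists s; apply/eqP.
Qed.

Lemma permute_continuous s : continuous (permute s).
Proof.
apply: continuous_comp_initial => y.
apply: (@cvg_mx _ _ (nbhs y) _) => i j; under eq_fun do rewrite mxE;
  rewrite mxE.
by apply: (@cvg_entry _ _ (nbhs y) _); exact: set_val_continuous.
Qed.

(** The saturation of an open set is the union of its translates by the
    finitely many permutations. *)
Lemma config_class_open (B : set E) : open B -> open (@config_class R n n.+1 K
  @` B).
Proof.
move=> oB; rewrite /open /= /quotient_open.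
rewrite (_ : _ @^-1` _ = \bigcup_(s in [set: 'S_n.+1]) (permute s @^-1` B)).
  apply: bigcup_open => s _; move/continuousP: (@permute_continuous s); exact.
apply/seteqP; split=> [y [z Bz /esym/config_classP[s e]]|y [s _ Bs]].
  by exists s => //=; rewrite -e.
by exists (permute s y) => //; apply/esym/config_classP; exists s.
Qed.

Lemma retract_continuous : continuous (fun p : R * E => retract p.1 p.2).
Proof.
apply: continuous_comp_initial => -[t y].
apply: (@cvg_retraction _ _ n2 _ (nbhs (t, y)) _ (fun p : R * E => set_val p.2)
  (set_val y) _ (@embedding_admissible y) (fun p : R * E => p.1) t).
  by apply: (@cvg_comp _ _ _ snd _ _ (nbhs y)); [exact: cvg_snd | exact:
    set_val_continuous].
exact: cvg_fst.
Qed.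

Lemma retract_permute t s y : retract t (permute s y) = permute s (retract t y).
Proof.
by apply: val_inj; apply: retraction_row_perm n2 _ _ _ (@embedding_admissible
  y).
Qed.

Lemma config_class_retract t y z : config_class y = config_class z ->
  config_class (retract t y) = config_class (retract t z).
Proof.
move=> /config_classP[s ->]; apply/config_classP; exists s.
exact: retract_permute.
Qed.

Definition config_retract t (c : C) : C := config_class (retract t
  (generic_quotient.repr c)).

Lemma config_class_repr (c : C) : config_class (generic_quotient.repr c) = c.
Proof. exact: reprK. Qed.

(** As the projection is open, a neighborhood of a chosen representative
    projects onto a neighborhood of its class. *)
Lemma config_retract_continuous :
  continuous (fun p : R * C => config_retract p.1 p.2).
Proof.
move=> [t c] U Uc; pose y := generic_quotient.repr c.
have gc : continuous (fun p : R * E => config_class (retract p.1 p.2)).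
  move=> p; apply: (@cvg_comp _ _ _ (fun p : R * E => retract p.1 p.2) _ _
    (nbhs (retract p.1 p.2))); first exact: retract_continuous.
  exact: pi_continuous.
have [[A B] /= [At By] AB] := gc (t, y) U Uc.
exists (A, @config_class R n n.+1 K @` B^°) => /=.
  split; first exact: At.
  apply: (@open_nbhs_nbhs C c); split.
    by apply: config_class_open; exact: open_interior.
  by exists y => //; exact: config_class_repr.
move=> [t' c'] /= [At' [z Bz zc]].
have := AB (t', z) (conj At' (interior_subset Bz)) => /=.
rewrite /config_retract; congr U; apply: config_class_retract.
by rewrite zc config_class_repr.
Qed.

End Configurations.

Theorem theorem2p6 (R : realType) (n : nat) (hn : (2 <= n)%N) :
  deformation_retracts_to R (@pyramidal_space R n (skeleton n.+1 (n - 2))).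
Proof.
exists (config_retract hn); split.
- by apply: continuous_subspaceT; exact: config_retract_continuous.
- move=> c; rewrite /config_retract -[RHS]config_class_repr; congr config_class.
  by apply: val_inj; exact: retraction0.
- move=> c; have gx := @embedding_admissible _ _ hn (generic_quotient.repr c).
  have [a pa] := model_pyramid hn gx.
  exists (retract hn 1 (generic_quotient.repr c)), a; split=> //.
  have e : set_val (retract hn 1 (generic_quotient.repr c)) =
      model (set_val (generic_quotient.repr c)) by exact: retraction1.
  by rewrite e.
- move=> t c _ [x [a [-> pa]]]; rewrite /config_retract.
  have -> : config_class
        (retract hn t (generic_quotient.repr (config_class x))) =
      config_class (retract hn t x).
    by apply: config_class_retract; exact: config_class_repr.
  congr config_class; apply: val_inj; apply: retraction_model.
  exact: (@model_fix _ _ hn _ _ (@embedding_admissible _ _ hn x) pa).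
Qed.
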